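(* Let $M$ be a loopless matroid of rank $r$ on a finite ground set $E$, let $\mathcal G$ be a building set of $M$ containing $E$, and let $d=r-1$. Write $\operatorname{td}(T_{M,\mathcal G})=\sum_{k=0}^d\operatorname{td}_k(T_{M,\mathcal G})$ with $\operatorname{td}_k$ of degree $k$. Then, as polynomials in $m$, $$\sum_{k=0}^d\frac{m^{d-k}}{(d-k)!}\int_{M,\mathcal G}\alpha^{d-k}\operatorname{td}_k(T_{M,\mathcal G})=\binom{m+d}{d}.$$ Equivalently, for every $0\le k\le d$, $$\int_{M,\mathcal G}\alpha^{d-k}\operatorname{td}_k(T_{M,\mathcal G})=(d-k)!\,[m^{d-k}]\binom{m+d}{d},$$ where $[m^{j}]$ denotes the coefficient of $m^j$ and $\binom{m+d}{d}=\frac{(m+1)(m+2)\cdots(m+d)}{d!}$.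
   Context: $M$ is a loopless matroid on a finite nonempty set $E$ with rank function $\operatorname{rk}$, $r=\operatorname{rk}(E)$, lattice of flats $\mathcal L(M)$ (minimum $\emptyset$, maximum $E$, join $\vee$). A subset $\mathcal G\subseteq\mathcal L(M)\setminus\{\emptyset\}$ is a building set if for every nonempty flat $F$, with $G_1,\dots,G_s$ the maximal elements of $\mathcal G$ contained in $F$, the join map $[\emptyset,G_1]\times\cdots\times[\emptyset,G_s]\to[\emptyset,F]$ is a poset isomorphism. A subset $\mathcal S\subseteq\mathcal G\setminus\{E\}$ is $\mathcal G$-nested if every collection of $m\ge2$ pairwise incomparable elements of $\mathcal S$ has join not in $\mathcal G$. In $N_E=\mathbb Z^E/\mathbb Z(1,\dots,1)$ let $v_F$ be the image of $\sum_{i\in F}e_i$; the nested-set fan $\Sigma_{M,\mathcal G}$ consists of the cones $\operatorname{cone}(v_F:F\in\mathcal S)$, $\mathcal S$ $\mathcal G$-nested, and $X_{M,\mathcal G}$ is its smooth toric variety. $\mathsf A(M,\mathcal G)$ is the Chow ring of $X_{M,\mathcal G}$, presented as $\mathbb Z[x_F:F\in\mathcal G\setminus\{E\}]$ modulo monomials $x_{F_1}\cdots x_{F_m}$ for non-nested $\{F_1,\dots,F_m\}$ and the linear forms $\sum_{F\ni i}x_F-\sum_{F\ni j}x_F$ ($i,j\in E$, sums over $F\in\mathcal G\setminus\{E\}$). Put $\alpha=\sum_{F\in\mathcal G\setminus\{E\},\,i\in F}x_F$ (independent of $i\in E$). $\int_{M,\mathcal G}:\mathsf A^{d}(M,\mathcal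 G)_{\mathbb Q}\to\mathbb Q$ is the degree isomorphism, normalized by $\int\alpha^d=1$. $\mathsf K(M,\mathcal G)=K_0(X_{M,\mathcal G})$; $\mathcal O(D)$ is the line bundle of $D\in\mathsf A^1(M,\mathcal G)$; $\operatorname{td}$ is the (multiplicative) Todd class on $K_0$. For $F\in\mathcal G\setminus\{E\}$ put $\theta_F^{\mathcal G}=\alpha-\sum_{H\in\mathcal G,\,F\subseteq H\subsetneq E}x_H$. The tangent class is $$T_{M,\mathcal G}:=r[\mathcal O(\alpha)]-[\mathcal O]+\sum_{F\in\mathcal G\setminus\{E\}}\Big([\mathcal O(x_F)]-[\mathcal O]+\operatorname{rk}(F)\big([\mathcal O(\theta_F^{\mathcal G})]-[\mathcal O(\theta_F^{\mathcal G}+x_F)]\big)\Big)\in\mathsf K(M,\mathcal G).$$ *)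

(* Defs.v *)
From HB Require Import structures.
From mathcomp Require Import all_boot all_order all_algebra ring_quotient.
From mathcomp Require Import boolp mpoly.

Set Implicit Arguments.
Unset Strict Implicit.
Unset Printing Implicit Defensive.

Import GRing.Theory.
Local Open Scope ring_scope.
Local Open Scope quotient_scope.

Record matroid (E : finType) := Matroid {
  rk : {set E} -> nat;
  rk_card : forall A, (rk A <= #|A|)%N;
  rk_mono : forall A B : {set E}, A \subset B -> (rk A <= rk B)%N;
  rk_submod : forall A B, (rk (A :|: B) + rk (A :&: B) <= rk A + rk B)%N }.

Section Matroid.
Variables (E : finType) (M : matroid E).
Implicit Types (A F H : {set E}) (G S T : {set {set E}}).

Definition loopless : Prop := forall e : E, rk M [set e] = 1%N.

Definition closure A : {set E} := [set e | rk M (e |: A) == rk M A].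

Definition flat F : bool := closure F == F.

(* The join, in the lattice of flats, of a collection of flats. *)
Definition join T : {set E} := closure (\bigcup_(F in T) F).

(* The interval [minimum, F] of the lattice of flats of a loopless matroid. *)
Definition interval F : {set {set E}} := [set H | flat H & H \subset F].

Definition max_in G F : {set {set E}} :=
  [set H | maxset (fun H' => (H' \in G) && (H' \subset F)) H].

(* The product of the intervals [minimum, H], H in max_in G F: its elements are
   the finite functions x with x H in the interval below H for H in max_in G F,
   extended by set0 elsewhere. *)
Definition interval_prod G F : pred {ffun {set E} -> {set E}} :=
  pfamily set0 (mem (max_in G F)) interval.

Definition join_map G F (x : {ffun {set E} -> {set E}}) : {set E} :=
  join [set x H | H in max_in G F].

(* The conditions on join_map say that it is a poset isomorphism from the
   product, with the componentwise order, onto interval F. *)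
Definition building_set G : Prop :=
  (forall H, H \in G -> flat H /\ H != set0) /\
  forall F, flat F -> F != set0 ->
    [/\ {in interval_prod G F &, injective (join_map G F)},
        [set join_map G F x | x in interval_prod G F] = interval F
      & {in interval_prod G F &, forall x y : {ffun {set E} -> {set E}},
          (forall H, H \in max_in G F -> x H \subset y H) <->
          join_map G F x \subset join_map G F y}].

Definition pairwise_incomparable T : bool :=
  [forall F in T, forall H in T, (F \subset H) ==> (F == H)].

Definition nested G S : bool :=
  (S \subset G :\ [set: E]) &&
  [forall T : {set {set E}},
     [&& T \subset S, (1 < #|T|)%N & pairwise_incomparable T]
       ==> (join T \notin G)].

End Matroid.

Section GeneratedIdeal.
Variables (R : comNzRingType) (P : R -> Prop).

Definition gen_ideal : {pred R} := fun p =>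
  `[< exists2 s : seq (R * R), (forall cg, cg \in s -> P cg.2) &
        p = \sum_(cg <- s) cg.1 * cg.2 >].

Lemma gen_ideal_ind (Q : R -> Prop) :
  Q 0 -> (forall c g p, P g -> Q p -> Q (c * g + p)) ->
  forall p, p \in gen_ideal -> Q p.
Proof.
move=> Q0 QD p /asboolP[s Ps ->]; elim: s Ps => [|[c g] s IHs] Ps.
  by rewrite big_nil.
rewrite big_cons; apply: QD; first by apply: (Ps (c, g)); rewrite mem_head.
by apply: IHs => cg cgs; apply: Ps; rewrite inE cgs orbT.
Qed.

Lemma gen_ideal_gen g : P g -> g \in gen_ideal.
Proof.
move=> Pg; apply/asboolP; exists [:: (1, g)].
  by move=> cg; rewrite inE => /eqP->.
by rewrite big_seq1 /= mul1r.
Qed.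

Lemma gen_ideal_closed (B : nzRingType) (f : {rmorphism R -> B}) :
  (forall g, P g -> f g = 0) -> idealr_closed gen_ideal.
Proof.
move=> fP; split.
- by apply/asboolP; exists [::] => //; rewrite big_nil.
- apply/negP => /(@gen_ideal_ind (fun p => f p = 0)) f1.
  suff /eqP: f 1 = 0 by rewrite rmorph1 oner_eq0.
  apply: f1 => [|c g p /fP fg fp]; first exact: rmorph0.
  by rewrite rmorphD rmorphM /= fg fp mulr0 addr0.
move=> a _ _ /asboolP[s Ps ->] /asboolP[t Pt ->]; apply/asboolP.
exists ([seq (a * cg.1, cg.2) | cg <- s] ++ t).
  move=> cg; rewrite mem_cat => /orP[/mapP[cg' /Ps ? ->] //|]; exact: Pt.
rewrite big_cat big_map mulr_sumr /=; congr (_ + _).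
by apply: eq_bigr => cg _; rewrite mulrA.
Qed.

End GeneratedIdeal.

Section Divisors.
Variables (E : finType) (G : {set {set E}}).

(* 'I_ndiv indexes the torus-invariant prime divisors, and Div below is the
   group of integral torus-invariant divisors. *)
Definition ndiv : nat := #|G :\ [set: E]|.
Definition divF (i : 'I_ndiv) : {set E} := enum_val i.

Definition Div := {ffun 'I_ndiv -> int}.

Definition xdiv (i : 'I_ndiv) : Div := [ffun j => (j == i)%:R].

(* The divisor depends on e, but neither its Chow class nor its line bundle
   does: see Cl_alpha and O_alpha. *)
Definition alpha (e : E) : Div := \sum_(i | e \in divF i) xdiv i.

Definition theta (e : E) (i : 'I_ndiv) : Div :=
  alpha e - \sum_(j | divF i \subset divF j) xdiv j.

End Divisors.

Section Chow.
Variables (E : finType) (M : matroid E) (G : {set {set E}}).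

Definition nonnested (S : {set 'I_(ndiv G)}) : bool :=
  ~~ nested M G [set divF i | i in S].

Lemma nonnested_card S : nonnested S -> (1 < #|S|)%N.
Proof.
apply: contraNT; rewrite -leqNgt => S1; apply/andP; split.
  by apply/subsetP => _ /imsetP[i _ ->]; exact: enum_valP.
apply/forallP => T; apply/implyP => /and3P[TS T1 _].
have := leq_trans T1 (leq_trans (subset_leq_card TS)
  (leq_trans (leq_imset_card _ _) S1)).
by rewrite ltnn.
Qed.

Variable R : comNzRingType.

Inductive chow_rel : {mpoly R[ndiv G]} -> Prop :=
| Chow_SR S of nonnested S : chow_rel (\prod_(i in S) 'X_i)
| Chow_lin (e f : E) :
    chow_rel (\sum_(i | e \in divF i) 'X_i - \sum_(i | f \in divF i) 'X_i).

Definition chow_ideal : {pred {mpoly R[ndiv G]}} := gen_ideal chow_rel.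

Lemma chow_ideal_closed : idealr_closed chow_ideal.
Proof.
apply: (@gen_ideal_closed _ _ _ (meval (fun=> 0))) => _ [S nS|e f].
  have /card_gt0P[i iS] : (0 < #|S|)%N by apply/ltnW/nonnested_card.
  by rewrite (bigD1 i) //= rmorphM /= mevalXU mul0r.
by rewrite rmorphB !rmorph_sum /= !big1 ?subrr // => i _; rewrite mevalXU.
Qed.

HB.instance Definition _ := isIdealr.Build _ chow_ideal chow_ideal_closed.

Definition Chow := {ideal_quot chow_ideal}.
HB.instance Definition _ := GRing.ComNzRing.on Chow.

Definition chow_pi : {mpoly R[ndiv G]} -> Chow := \pi_Chow.

Definition Cl (D : Div G) : Chow := chow_pi (\sum_i (D i)%:~R *: 'X_i).

Definition scal (c : R) (a : Chow) : Chow := chow_pi c%:MP * a.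

Definition chow_deg (k : nat) (a : Chow) : Prop :=
  exists2 p : {mpoly R[ndiv G]}, p \is k.-homog & a = chow_pi p.

(* The component of degree k of an element; it does not depend on the
   representative, see chow_compE. *)
Definition chow_comp (k : nat) (a : Chow) : Chow :=
  chow_pi (pihomog mdeg k (repr a)).

End Chow.

Arguments chow_ideal {E} M G R _.
Arguments chow_deg {E M G R} k a.

Section ChowTheory.
Variables (E : finType) (M : matroid E) (G : {set {set E}}) (R : comNzRingType).
Notation A := (Chow M G R).
Notation P := {mpoly R[ndiv G]}.
Notation pi := (@chow_pi E M G R).

Lemma chow_piD p q : pi (p + q) = pi p + pi q.
Proof. exact: (rmorphD (\pi_(Chow M G R))). Qed.

Lemma chow_piM p q : pi (p * q) = pi p * pi q.
Proof. exact: (rmorphM (\pi_(Chow M G R))). Qed.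

Lemma chow_pi_eq p q : pi p = pi q <-> p - q \in chow_ideal M G R.
Proof.
by rewrite Quotient.idealrBE; split=> [/eqP|/eqP].
Qed.

Lemma Cl_alpha (e f : E) : Cl M R (alpha G e) = Cl M R (alpha G f).
Proof.
suff aE e' : \sum_i (alpha G e' i)%:~R *: 'X_i
             = \sum_(i | e' \in divF i) 'X_i :> P.
  by apply/chow_pi_eq; rewrite !aE; apply: gen_ideal_gen; exact: Chow_lin.
rewrite [RHS]big_mkcond; apply: eq_bigr => i _.
rewrite sum_ffunE big_mkcond (bigD1 i) //= ffunE eqxx big1 => [|j /negPf ij].
  by rewrite addr0; case: ifP => _; rewrite ?scale1r ?scale0r.
by rewrite ffunE eq_sym ij if_same.
Qed.

Lemma pihomogM_homog k d (p g : P) : g \is d.-homog ->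
  pihomog mdeg k (p * g) =
  if (d <= k)%N then pihomog mdeg (k - d) p * g else 0.
Proof.
move=> hg; rewrite [in LHS](pihomog_partitionE (leqnn (mmeasure mdeg p))).
rewrite mulr_suml raddf_sum /=.
have h j : pihomog mdeg k (pihomog mdeg j p * g) =
    if (j + d)%N == k then pihomog mdeg j p * g else 0.
  have hh := dhomogM (pihomogP mdeg j p) hg.
  case: eqP => [<-|/eqP n]; first by rewrite pihomog_dE.
  by rewrite (pihomog_ne0 n hh).
rewrite (eq_bigr _ (fun (j : 'I__) _ => h j)) -big_mkcond.
case: leqP => [dk|kd]; last first.
  by rewrite big1 // => j /eqP jk; move: kd; rewrite -jk ltnNge leq_addl.
have hj j : ((j + d)%N == k) = (j == (k - d)%N).
  by rewrite -[in LHS](subnK dk) eqn_add2r.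
case: (ltnP (k - d) (mmeasure mdeg p)) => kdp; last first.
  have -> : pihomog mdeg (k - d) p = 0.
    rewrite pihomogE big1_seq // => m /andP[/eqP mk mp].
    by have := mmeasure_mnm_lt mdeg mp; rewrite mk ltnNge kdp.
  rewrite mul0r big1 // => j; rewrite hj => /eqP jE.
  by have := ltn_ord j; rewrite jE ltnNge kdp.
rewrite (eq_bigl (xpred1 (Ordinal kdp))) ?big_pred1_eq //.
Qed.

Lemma chow_rel_homog (g : P) : chow_rel M g -> exists d, g \is d.-homog.
Proof.
case=> [S _|e f].
  exists #|S|; rewrite -sum1_card.
  apply: (big_ind2 (fun (p : P) k => p \is k.-homog)) => [|p k q l|i _].
  - exact: dhomog1.
  - exact: dhomogM.
  by rewrite dhomogX /= mdeg1.
by exists 1%N; rewrite rpredB // rpred_sum // => i _; rewrite dhomogX /= mdeg1.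
Qed.

Lemma chow_compE k p : chow_comp k (pi p) = pi (pihomog mdeg k p).
Proof.
apply/chow_pi_eq; rewrite -raddfB /=.
have : repr (pi p) - p \in chow_ideal M G R by apply/chow_pi_eq/reprK.
elim/gen_ideal_ind => [|c g q Pg IHq].
  by rewrite raddf0; exact: idealr0.
have [d gd] := chow_rel_homog Pg.
rewrite raddfD /= (pihomogM_homog _ _ gd); apply: rpredD => //.
by case: ifP => _; [apply/idealMr/gen_ideal_gen | exact: idealr0].
Qed.

End ChowTheory.

Section KRing.
Variables (E : finType) (M : matroid E) (G : {set {set E}}).
Notation n := (ndiv G).

Definition Kpoly := {mpoly int[n + n]}.
Definition Ku (i : 'I_n) : Kpoly := 'X_(lshift n i).
Definition Kw (i : 'I_n) : Kpoly := 'X_(rshift n i).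

(* Presentation of the K-ring of the smooth toric variety of the nested-set
   fan, analogous to that of the Chow ring.  The generators Ku i and Kw i are
   the classes of O(x_i) and O(- x_i), so that 1 - Kw i is the class of the
   structure sheaf of the prime divisor x_i.  Prime divisors not spanning a
   cone have empty intersection, and e_i - e_j in the dual of N_E gives a
   rational function trivializing the difference of alpha e and alpha f. *)
Inductive K_rel : Kpoly -> Prop :=
| K_inv i : K_rel (Ku i * Kw i - 1)
| K_SR S of nonnested M S : K_rel (\prod_(i in S) (1 - Kw i))
| K_lin (e f : E) :
    K_rel (\prod_(i | e \in divF i) Ku i - \prod_(i | f \in divF i) Ku i).

Definition K_ideal : {pred Kpoly} := gen_ideal K_rel.

Lemma K_ideal_closed : idealr_closed K_ideal.
Proof.
apply: (@gen_ideal_closed _ _ _ (meval (fun=> 1))) => _ [i|S nS|e f].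
- by rewrite rmorphB rmorphM rmorph1 /= !mevalXU mulr1 subrr.
- have /card_gt0P[i iS] : (0 < #|S|)%N by apply/ltnW/(nonnested_card nS).
  by rewrite (bigD1 i) //= rmorphM rmorphB rmorph1 /= mevalXU subrr mul0r.
by rewrite rmorphB !rmorph_prod /= !big1 ?subrr // => i _; rewrite mevalXU.
Qed.

HB.instance Definition _ := isIdealr.Build _ K_ideal K_ideal_closed.

Definition Kring := {ideal_quot K_ideal}.
HB.instance Definition _ := GRing.ComNzRing.on Kring.

Definition K_pi : Kpoly -> Kring := \pi_Kring.

(* The class of the line bundle of a divisor; it depends only on the class of
   the divisor in the integral Chow ring, see O_Cl. *)
Definition line_bundle (D : Div G) : Kring :=
  \prod_i match D i with
          | Posz k => K_pi (Ku i) ^+ k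
          | Negz k => K_pi (Kw i) ^+ k.+1
          end.

Local Notation O := line_bundle.

Definition tangent (e : E) : Kring :=
  O (alpha G e) *+ rk M [set: E] - 1 +
  \sum_(i : 'I_n)
     (O (xdiv i) - 1 +
      (O (theta e i) - O (theta e i + xdiv i)) *+ rk M (divF i)).

End KRing.

Section KTheory.
Variables (E : finType) (M : matroid E) (G : {set {set E}}).
Notation n := (ndiv G).
Notation pi := (@K_pi E M G).
Notation O := (@line_bundle E M G).

Lemma K_pi_rel p : K_rel M p -> pi p = 0.
Proof.
move=> Pp; rewrite -[RHS](rmorph0 (\pi_(Kring M G))).
by apply/eqP; rewrite -Quotient.idealrBE subr0 gen_ideal_gen.
Qed.

Lemma K_pi_inv i : pi (Ku i) * pi (Kw i) = 1.
Proof.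
have := K_pi_rel (K_inv M i).
rewrite /K_pi rmorphB rmorphM rmorph1 => /eqP.
by rewrite subr_eq0 => /eqP.
Qed.

Lemma O0 : O 0 = 1.
Proof. by rewrite /line_bundle big1 // => i _; rewrite ffunE. Qed.

Lemma O_add D D' : O (D + D') = O D * O D'.
Proof.
rewrite /line_bundle -big_split; apply: eq_bigr => i _ /=; rewrite ffunE.
set u := pi (Ku i); set w := pi (Kw i).
have uw : u * w = 1 by exact: K_pi_inv.
pose h (z : int) := match z with Posz k => u ^+ k | Negz k => w ^+ k.+1 end.
have hN k : h (- k%:Z) = w ^+ k by case: k.
have hB a b : h (a%:Z - b%:Z) = u ^+ a * w ^+ b.
  case: (leqP b a) => [ba|/ltnW ab].
    rewrite subzn //= -{2}(subnK ba) exprD -mulrA -exprMn uw expr1n.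
    by rewrite mulr1.
  rewrite -opprB subzn // hN -{2}(subnK ab) addnC exprD mulrA -exprMn uw.
  by rewrite expr1n mul1r.
have decz (z : int) : exists a b : nat, z = a%:Z - b%:Z.
  case: z => k; first by exists k, 0%N; rewrite subr0.
  by exists 0%N, k.+1; rewrite NegzE sub0r.
change (h (D i + D' i) = h (D i) * h (D' i)).
have [a [b ->]] := decz (D i); have [c [d ->]] := decz (D' i).
have -> : a%:Z - b%:Z + (c%:Z - d%:Z) = (a + c)%N%:Z - (b + d)%N%:Z.
  by rewrite addrACA -opprD -!PoszD.
by rewrite !hB !exprD mulrACA.
Qed.

Lemma O_xdiv i : O (xdiv i) = pi (Ku i).
Proof.
rewrite /line_bundle (bigD1 i) //= ffunE eqxx big1 ?mulr1 //.
by move=> j /negPf ji; rewrite ffunE ji.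
Qed.

Lemma O_alphaE e : O (alpha G e) = pi (\prod_(i | e \in divF i) Ku i).
Proof.
rewrite /K_pi rmorph_prod /= /alpha.
by apply: (big_ind2 (fun D k => O D = k)) => [|? ? ? ? <- <-|i _];
  [exact: O0 | exact: O_add | exact: O_xdiv].
Qed.

Lemma O_alpha e f : O (alpha G e) = O (alpha G f).
Proof.
have := K_pi_rel (K_lin M G e f).
rewrite !O_alphaE /K_pi rmorphB /= => /eqP.
by rewrite subr_eq0 => /eqP.
Qed.

Lemma O_mulz D (z : int) : O D = 1 -> O (D *~ z) = 1.
Proof.
move=> OD; have ODn k : O (D *+ k) = 1.
  by elim: k => [|k IHk]; rewrite ?O0 // mulrS O_add OD IHk mulr1.
case: z => k; first exact: ODn.
by rewrite -[LHS]mulr1 -{1}(ODn k.+1) -O_add NegzE mulrNz addNr O0.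
Qed.

Lemma O_Cl D D' : Cl M int D = Cl M int D' -> O D = O D'.
Proof.
pose ev := meval (fun=> 0 : int) : {rmorphism {mpoly int[n]} -> int}.
pose L (p : {mpoly int[n]}) : Div G := [ffun i => ev p^`M(i)].
have LD p q : L (p + q) = L p + L q.
  by apply/ffunP => i; rewrite !ffunE mderivD rmorphD.
have LX i j : ev ('X_j)^`M(i) = (i == j)%:R.
  rewrite mderivX mnm1E eq_sym; case: eqP => [->|_]; last first.
    by rewrite scale0r rmorph0.
  rewrite scale1r (_ : (U_(j) - U_(j))%MM = 0%MM) ?mpolyX0 ?rmorph1 //.
  by apply/mnmP => l; rewrite mnmBE subnn mnm0E.
have dD i : {morph (fun p : {mpoly int[n]} => ev p^`M(i)) : p q / p + q}.
  by move=> p q; rewrite mderivD rmorphD.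
have d0 i : ev (0 : {mpoly int[n]})^`M(i) = 0 by rewrite mderiv0 rmorph0.
have L1 (B : Div G) : L (\sum_i (B i)%:~R *: 'X_i) = B.
  apply/ffunP => i; rewrite ffunE (big_morph _ (dD i) (d0 i)) (bigD1 i) //= big1 => [|j ji].
    by rewrite addr0 mderivZ /ev mevalZ LX eqxx mulr1 intz.
  by rewrite mderivZ /ev mevalZ LX eq_sym (negPf ji) mulr0.
have ev0 g : chow_rel M g -> ev g = 0.
  case=> [S nS|e f].
    have /card_gt0P[i iS] : (0 < #|S|)%N by apply/ltnW/(nonnested_card nS).
    by rewrite (bigD1 i) //= rmorphM /= mevalXU mul0r.
  by rewrite rmorphB !rmorph_sum /= !big1 ?subrr // => i _; rewrite mevalXU.
have LM c g : chow_rel M g -> L (c * g) = L g *~ ev c.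
  move=> Pg; apply/ffunP => i; rewrite ffunMzE !ffunE mderivM rmorphD !rmorphM.
  by rewrite (ev0 _ Pg) mulr0 add0r -mulrzl intz.
have LI p : p \in chow_ideal M G int -> O (L p) = 1.
  elim/gen_ideal_ind => [|c g q Pg IHq].
    rewrite (_ : L 0 = 0) ?O0 //; apply/ffunP => i.
    by rewrite !ffunE mderiv0 rmorph0.
  rewrite LD O_add IHq mulr1 LM //; apply: O_mulz.
  case: Pg => [S nS|e f].
    rewrite (_ : L _ = 0) ?O0 //; apply/ffunP => i; rewrite !ffunE.
    have /card_gt1P[j [k [jS kS jk]]] := nonnested_card nS.
    rewrite (bigD1 j) //= (bigD1 k) ?kS 1?eq_sym //= !mderivM.
    rewrite !(rmorphD, rmorphM) /= !mevalXU.
    by rewrite !(mul0r, mulr0, addr0).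
  have -> : L (\sum_(i | e \in divF i) 'X_i - \sum_(i | f \in divF i) 'X_i)
            = alpha G e - alpha G f.
    apply/ffunP => i; rewrite !ffunE mderivB rmorphB.
    rewrite !(big_morph _ (dD i) (d0 i)) !sum_ffunE.
    by congr (_ - _); apply: eq_bigr => j _; rewrite ffunE LX.
  have := O_add (alpha G e - alpha G f) (alpha G f).
  rewrite subrK (O_alpha e f) => h.
  have h2 : O (alpha G f) * O (- alpha G f) = 1 by rewrite -O_add subrr O0.
  by rewrite -[LHS]mulr1 -{1}h2 mulrA -h h2.
move=> /chow_pi_eq /LI h.
rewrite -(L1 D) -(subrK (\sum_i (D' i)%:~R *: 'X_i) (\sum_i _)).
by rewrite LD O_add h mul1r L1.
Qed.

End KTheory.

(* The first n coefficients of the power series t / (1 - exp (- t)). *)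
Fixpoint todd_seq (n : nat) : seq rat :=
  if n is k.+1 then
    let s := todd_seq k in
    rcons s ((k == 0)%:R -
             \sum_(j < k) s`_j * ((-1) ^+ (k - j) / ((k - j).+1)`!%:R))
  else [::].

Definition todd_coef (k : nat) : rat := (todd_seq k.+1)`_k.

(* The product of the series of coefficients todd_coef with the series
   (1 - exp (- t)) / t is 1. *)
Lemma todd_coefP k :
  \sum_(j < k.+1) todd_coef j * ((-1) ^+ (k - j) / ((k - j).+1)`!%:R)
  = (k == 0)%:R.
Proof.
have sz m : size (todd_seq m) = m.
  by elim: m => //= m IH; rewrite size_rcons IH.
have stable m j : (j < m)%N -> (todd_seq m)`_j = todd_coef j.
  elim: m => // m IH; rewrite ltnS leq_eqVlt => /predU1P[-> //|jm].
  by rewrite /= nth_rcons sz jm IH.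
rewrite big_ord_recr /= subnn factS fact0 muln1 expr0 divr1.
rewrite {2}/todd_coef [todd_seq _]/= nth_rcons sz ltnn eqxx addrC.
by rewrite (eq_bigr _ (fun j _ => congr1 ( *%R^~ _) (stable _ _ (ltn_ord j))))
  subrK.
Qed.

Section Todd.
Variables (E : finType) (M : matroid E) (G : {set {set E}}).
Notation AQ := (Chow M G rat).
Notation d := (rk M [set: E]).-1.

(* The value of t / (1 - exp (- t)) at c_1 of O(D).  The Chow ring vanishes in
   degrees larger than d. *)
Definition todd_line (D : Div G) : AQ :=
  \sum_(k < d.+1) scal (todd_coef k) (Cl M rat D ^+ k).

(* Classes of line bundles generate Kring M G as a group, so these two
   conditions determine the Todd class. *)
Definition is_todd (td : Kring M G -> AQ) : Prop :=
  (forall a b, td (a + b) = td a * td b) /\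
  (forall D, td (line_bundle M D) = todd_line D).

(* An isomorphism of rat-vector spaces from the degree d piece onto rat, sending
   the d-th power of alpha to 1; its values in other degrees are irrelevant. *)
Definition is_degree (deg : AQ -> rat) : Prop :=
  [/\ forall c a b, chow_deg d a -> chow_deg d b ->
        deg (scal c a + b) = c * deg a + deg b,
      forall a b, chow_deg d a -> chow_deg d b -> deg a = deg b -> a = b,
      forall c, exists2 a, chow_deg d a & deg a = c
    & forall e : E, deg (Cl M rat (alpha G e) ^+ d) = 1].

End Todd.

(* Main.v *)
From HB Require Import structures.
Require Import Defs.
From mathcomp Require Import all_boot all_order all_algebra.
From mathcomp Require Import boolp mpoly ring_quotient ring.

Set Implicit Arguments.
Unset Strict Implicit.
Unset Printing Implicit Defensive.

Import GRing.Theory.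
Local Open Scope ring_scope.

(* The tangent class is that of an iterated blow-up of P^d, in which the flat F
   of the building set gives a centre cut out by rk F divisors of class
   theta_F + x_F, with exceptional divisor x_F and proper transforms theta_F.
   Its Todd class is td(alpha)^r times the product over F of
   td(x_F) (td(theta_F) / td(theta_F + x_F))^(rk F).  Each of these factors can
   be replaced by 1 when integrating against classes generated by the x_H with
   H not contained in F, because of two relations:
   - theta_F^(rk F) = 0, by expanding over a basis of F;
   - x_F p = 0 for p in these classes of degree at least r - rk F.
   By the first one and a universal identity between power series (Grothendieck-
   Riemann-Roch for the blow-up), the difference with 1 is a combination of the
   x_F^k with 0 < k < rk F, which integrate to 0 by the second one.  Removing
   the flats by increasing size leaves td(alpha)^(d+1), as for P^d. *)

(** * Formal power series *)

Record fps (K : Type) := Fps { fcoef :> nat -> K }.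

Lemma fpsP (K : Type) (u v : fps K) : (forall k, u k = v k) <-> u = v.
Proof. by split=> [|-> //]; case: u v => [u] [v] /= /funext ->. Qed.

HB.instance Definition _ (K : Type) := gen_eqMixin (fps K).
HB.instance Definition _ (K : Type) := gen_choiceMixin (fps K).

Section FpsRing.
Variable K : comNzRingType.
Implicit Types u v w : fps K.

Definition fps0 := Fps (fun=> 0 : K).
Definition fps_opp u := Fps (fun k => - u k).
Definition fps_add u v := Fps (fun k => u k + v k).
Definition fps1 := Fps (fun k => (k == 0)%:R : K).
Definition fps_mul u v := Fps (fun k => \sum_(i < k.+1) u i * v (k - i)%N).

Lemma fps_addA : associative fps_add.
Proof. by move=> u v w; apply/fpsP => k /=; rewrite addrA. Qed.
Lemma fps_addC : commutative fps_add.
Proof. by move=> u v; apply/fpsP => k /=; rewrite addrC. Qed.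
Lemma fps_add0 : left_id fps0 fps_add.
Proof. by move=> u; apply/fpsP => k /=; rewrite add0r. Qed.
Lemma fps_addN : left_inverse fps0 fps_opp fps_add.
Proof. by move=> u; apply/fpsP => k /=; rewrite addNr. Qed.

HB.instance Definition _ :=
  GRing.isZmodule.Build (fps K) fps_addA fps_addC fps_add0 fps_addN.

Definition fps_trunc N u : {poly K} := \poly_(i < N) u i.

(** Coefficients of index below [N] of a product only involve those of the factors, so associativity
    and commutativity reduce to polynomials. *)
Lemma fps_mul_trunc N u v k : (k < N)%N ->
  fps_mul u v k = (fps_trunc N u * fps_trunc N v)`_k.
Proof.
move=> kN; rewrite coefM; apply: eq_bigr => i _.
rewrite !coef_poly (leq_ltn_trans (leq_subr _ _) kN).
by rewrite (leq_ltn_trans _ kN) // -ltnS.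
Qed.

Lemma fps_mulA : associative fps_mul.
Proof.
move=> u v w; apply/fpsP => k; pose t := fps_trunc k.+1.
transitivity (t u * (t v * t w))`_k.
  rewrite (@fps_mul_trunc k.+1) // !coefM; apply: eq_bigr => i _; congr (_ * _).
  by rewrite coef_poly ltnS leq_subr (@fps_mul_trunc k.+1) // ltnS leq_subr.
rewrite mulrA (@fps_mul_trunc k.+1) // !coefM; apply: eq_bigr => i _.
by rewrite [in RHS]coef_poly ltn_ord (@fps_mul_trunc k.+1).
Qed.

Lemma fps_mulC : commutative fps_mul.
Proof.
by move=> u v; apply/fpsP => k; rewrite !(@fps_mul_trunc k.+1) // mulrC.
Qed.

Lemma fps_mul1 : left_id fps1 fps_mul.
Proof.
move=> u; apply/fpsP => k /=; rewrite big_ord_recl /= mul1r subn0.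
by rewrite big1 ?addr0 // => i _; rewrite mul0r.
Qed.

Lemma fps_mulDl : left_distributive fps_mul fps_add.
Proof.
move=> u v w; apply/fpsP => k /=; rewrite -big_split.
by apply: eq_bigr => i _; rewrite mulrDl.
Qed.

Lemma fps1_neq0 : fps1 != 0.
Proof. by apply/eqP => /fpsP /(_ 0%N) /eqP; rewrite oner_eq0. Qed.

HB.instance Definition _ := GRing.Zmodule_isComNzRing.Build (fps K)
  fps_mulA fps_mulC fps_mul1 fps_mulDl fps1_neq0.

Lemma fcoef1 k : (1 : fps K) k = (k == 0)%:R. Proof. by []. Qed.
Lemma fcoefD u v k : (u + v) k = u k + v k. Proof. by []. Qed.
Lemma fcoefB u v k : (u - v) k = u k - v k. Proof. by []. Qed.
Lemma fcoefM u v k : (u * v) k = \sum_(i < k.+1) u i * v (k - i)%N.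
Proof. by []. Qed.
Lemma fcoef_sum (I : Type) (r : seq I) (P : pred I) (F : I -> fps K) k :
  (\sum_(i <- r | P i) F i) k = \sum_(i <- r | P i) F i k.
Proof. by elim/big_rec2: _ => // i x y _ <-. Qed.
Lemma fcoefMn u n k : (u *+ n) k = u k *+ n.
Proof. by elim: n => // n IHn; rewrite !mulrS -IHn. Qed.

(** The monomial c T. The formal variable T records the degree, so a divisor class [a] enters a
    series as [cT a]. *)
Definition cT (c : K) : fps K := Fps (fun k => (k == 1)%:R * c).

Lemma fcoef_cTM c u k : (cT c * u) k = if k is k'.+1 then c * u k' else 0.
Proof.
rewrite fcoefM; case: k => [|k]; first by rewrite big_ord1 /= !mul0r.
rewrite big_ord_recl /= !mul0r add0r big_ord_recl /= mul1r subSS subn0.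
by rewrite big1 ?addr0 // => i _; rewrite /= !mul0r.
Qed.

Lemma fcoef_cTXM c n u k :
  (cT c ^+ n * u) k = if (n <= k)%N then c ^+ n * u (k - n)%N else 0.
Proof.
elim: n k => [|n IHn] k; first by rewrite !expr0 !mul1r subn0.
rewrite exprS -mulrA fcoef_cTM; case: k => // k.
by rewrite IHn ltnS; case: ifP => _; rewrite ?mulr0 // exprS mulrA.
Qed.

(* The operator T d/dT. *)
Definition fderiv u : fps K := Fps (fun k => u k *+ k).

Lemma fderivM u v : fderiv (u * v) = fderiv u * v + u * fderiv v.
Proof.
apply/fpsP => k; rewrite fcoefD !fcoefM /= -big_split /= -sumrMnl.
apply: eq_bigr => i _; rewrite mulrnAl mulrnAr -mulrnDr subnKC //.
by rewrite -ltnS.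
Qed.

Lemma fderivX u n : fderiv (u ^+ n.+1) = u ^+ n * fderiv u *+ n.+1.
Proof.
elim: n => [|n IHn]; first by rewrite expr1 expr0 mul1r mulr1n.
by rewrite exprS fderivM IHn !mulrSr !exprS; ring.
Qed.

End FpsRing.

Lemma cT_inj (K : comNzRingType) (c : K) (u v : fps K) :
  GRing.lreg c -> cT c * u = cT c * v -> u = v.
Proof.
move=> cI /fpsP uv; apply/fpsP => k; have := uv k.+1.
by rewrite !fcoef_cTM => /cI.
Qed.

Lemma cTX_inj (K : comNzRingType) (c : K) n (u v : fps K) :
  GRing.lreg c -> cT c ^+ n * u = cT c ^+ n * v -> u = v.
Proof.
move=> cI; elim: n u v => [|n IHn] u v; first by rewrite expr0 !mul1r.
by rewrite exprSr -!mulrA => /IHn /(cT_inj cI).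
Qed.

(* The substitution of a T for T. *)
Section Substitution.
Variables (K L : comNzRingType) (f : {rmorphism K -> L}) (a : L).

Definition fsub (u : fps K) : fps L := Fps (fun k => f (u k) * a ^+ k).

Lemma fcoef_fsub u k : fsub u k = f (u k) * a ^+ k. Proof. by []. Qed.

Lemma fsub_zmod : zmod_morphism fsub.
Proof.
by move=> u v; apply/fpsP => k; rewrite /= rmorphB mulrBl.
Qed.

Lemma fsub_monoid : monoid_morphism fsub.
Proof.
split; first by apply/fpsP => -[|k] /=; rewrite ?rmorph1 ?rmorph0 ?mul1r ?mul0r.
move=> u v; apply/fpsP => k; rewrite /= rmorph_sum mulr_suml.
apply: eq_bigr => i _; rewrite rmorphM /= mulrACA -exprD subnKC //.
by rewrite -ltnS.
Qed.

HB.instance Definition _ := GRing.isZmodMorphism.Build _ _ fsub fsub_zmod.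
HB.instance Definition _ := GRing.isMonoidMorphism.Build _ _ fsub fsub_monoid.

Lemma fsub_cT c : fsub (cT c) = cT (f c * a).
Proof.
apply/fpsP => k /=.
case: (k =P 1%N) => [->|_]; last by rewrite !mul0r rmorph0 mul0r.
by rewrite !mul1r expr1.
Qed.

End Substitution.

Lemma fsub_comp (K L N : comNzRingType) (f : {rmorphism K -> L})
    (g : {rmorphism L -> N}) (h : {rmorphism K -> N}) a b u :
  (forall x, h x = g (f x)) ->
  fsub g b (fsub f a u) = fsub h (g a * b) u.
Proof.
move=> hE; apply/fpsP => k /=.
by rewrite rmorphM rmorphXn -mulrA -exprMn hE.
Qed.

(** * The exponential and Todd series *)

Definition expS : fps rat := Fps (fun k => (k`!%:R)^-1).
Definition toddS : fps rat := Fps todd_coef.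

Lemma todd_coef0 : todd_coef 0 = 1.
Proof.
have := todd_coefP 0; rewrite big_ord1 subnn expr0 divr1 => ->.
rewrite eqxx; reflexivity.
Qed.

Section Exponential.
Variables (K : comNzRingType) (f : {rmorphism rat -> K}).

Notation E a := (fsub f a expS).
Notation td a := (fsub f a toddS).

Lemma expS_add a b : E a * E b = E (a + b).
Proof.
apply/fpsP => k; rewrite fcoefM /= addrC exprDn mulr_sumr.
apply: eq_bigr => i _.
have ik : (i <= k)%N by rewrite -ltnS.
rewrite mulrACA -rmorphM /= mulrnAr -mulrnAl -[f _ *+ _]mulr_natr.
rewrite -[in RHS](rmorph_nat f) -rmorphM [b ^+ _ * _]mulrC; congr (f _ * _).
rewrite -(bin_fact ik) !natrM.
have n0 m : (0 < m)%N -> (m%:R : rat) != 0.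
  by rewrite lt0n Num.Theory.pnatr_eq0.
by field; rewrite !n0 ?fact_gt0 ?bin_gt0.
Qed.

(** The series (1 - exp (- t)) / t, inverse to the Todd series. *)
Definition itoddS : fps rat := Fps (fun k => (-1) ^+ k / (k.+1)`!%:R).

Lemma todd_itodd : toddS * itoddS = 1.
Proof. by apply/fpsP => k; rewrite fcoefM todd_coefP. Qed.

Lemma td_expS a : td a * (1 - E (- a)) = cT a.
Proof.
have -> : 1 - E (- a) = cT a * fsub f a itoddS.
  apply/fpsP => k; rewrite fcoef_cTM fcoefB fcoef1 /=.
  case: k => [|k]; first by rewrite fact0 invr1 (rmorph1 f) expr0 mulr1 subrr.
  have -> (x : rat) : f ((-1) ^+ k / x) = (-1) ^+ k * f x^-1.
    by rewrite rmorphM rmorphXn rmorphN1.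
  by move: (f _) => c; rewrite sub0r [(- a) ^+ _]exprNn !exprS; ring.
by rewrite mulrCA -rmorphM todd_itodd rmorph1 mulr1.
Qed.

Lemma fderiv_expS a : fderiv (E a) = cT a * E a.
Proof.
apply/fpsP => -[|k]; rewrite fcoef_cTM //= exprS -mulrnAl -mulr_natr mulrCA.
congr (_ * (_ * _)); rewrite -(rmorph_nat f) -rmorphM; congr (f _).
by rewrite factS natrM invfM mulrC mulrA mulfV ?mul1r // Num.Theory.pnatr_eq0.
Qed.

(** Apply T d/dT to [td_expS] and multiply by [td 1]: the factor [1 - E (-1)] becomes T, which can
    then be cancelled. *)
Lemma fderiv_td : fderiv (td 1) = td 1 - td 1 ^+ 2 * E (-1).
Proof.
have /(congr1 (@fderiv K)) := td_expS 1.
have -> : fderiv (cT 1) = cT 1 :> fps K.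
  by apply/fpsP => -[|[|k]] //=; rewrite !mul0r mul0rn.
have D1 : fderiv (1 - E (-1)) = cT 1 * E (-1).
  have -> : cT 1 = - cT (-1) :> fps K.
    by apply/fpsP => k /=; rewrite mulrN opprK.
  rewrite mulNr -fderiv_expS; apply/fpsP => -[|k] //=.
    by rewrite mulr0n oppr0.
  by rewrite sub0r mulNrn.
rewrite fderivM D1 => /(congr1 (fun u => td 1 * u)) H.
apply: (@cT_inj _ 1); first exact: lreg1.
have := td_expS 1; set h := 1 - _ in H * => hE.
transitivity (td 1 * cT 1 - td 1 * (td 1 * (cT 1 * E (-1)))).
  by rewrite -[in RHS]H -hE; ring.
by ring.
Qed.

(* Applying [T d/dT] to [E (z + 1) * td 1 ^+ d] shows that the left-hand side
   [P d z] satisfies [d P d z = (z + 1) P (d - 1) (z + 1)]. *)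
Lemma expS_td_coef d z :
  (E z * td 1 ^+ d.+1) d =
  f (d`!%:R)^-1 * \prod_(1 <= j < d.+1) (z + j%:R).
Proof.
elim: d z => [|d IHd] z.
  rewrite fcoefM big_ord1 big_geq // fact0 invr1 /= invr1 !(rmorph1 f) !mulr1.
  by rewrite subnn todd_coef0 (rmorph1 f) mul1r.
have D : fderiv (E (z + 1) * td 1 ^+ d.+1) =
    cT (z + 1) * (E (z + 1) * td 1 ^+ d.+1)
    + (E (z + 1) * td 1 ^+ d.+1 - E z * td 1 ^+ d.+2) *+ d.+1.
  rewrite fderivM fderiv_expS fderivX fderiv_td.
  have -> : E z = E (z + 1) * E (-1) by rewrite expS_add addrK.
  move: (E _) (E _) (td 1) (cT _) => u v t c.
  by rewrite !exprS; ring.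
(* In degree [d.+1] the operator multiplies by [d.+1], so the coefficient [t] of
   [E (z + 1) * td 1 ^+ d.+1] cancels from both sides. *)
have /fpsP /(_ d.+1) := D.
rewrite fcoefD fcoef_cTM fcoefMn fcoefB IHd [fcoef (fderiv _) _]/=.
set t := fcoef _ _; rewrite mulrnBl addrCA -[LHS]addr0 => /addrI /esym /eqP.
rewrite subr_eq0 => /eqP H.
have -> : \prod_(1 <= j < d.+2) (z + j%:R)
        = (z + 1) * \prod_(1 <= j < d.+1) (z + 1 + j%:R).
  rewrite big_nat_recl //; congr (_ * _).
  by apply: eq_bigr => j _; rewrite -addrA -mulrS.
have -> : f ((d.+1)`!%:R)^-1 = f (d.+1%:R)^-1 * f (d`!%:R)^-1.
  by rewrite -rmorphM factS natrM invfM.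
rewrite -mulrA [f (d`!%:R)^-1 * _]mulrCA H.
set p := fcoef _ _; rewrite -[p *+ _]mulr_natr mulrCA.
rewrite -(rmorph_nat f) -rmorphM mulVf ?rmorph1 ?mulr1 //.
by rewrite Num.Theory.pnatr_eq0.
Qed.

End Exponential.

(** * The universal blow-up identity *)

Lemma fsub1 (u : fps rat) : fsub idfun 1 u = u.
Proof. by apply/fpsP => k /=; rewrite expr1n mulr1. Qed.

(** At [z = -1] the factor [j = 1] of the product in [expS_td_coef] vanishes, unless the product is
    empty. *)
Lemma expSN_todd_coef m :
  (fsub idfun (-1) expS * toddS ^+ m.+1) m = (m == 0)%:R.
Proof.
have := expS_td_coef idfun m (-1); rewrite fsub1 => ->.
case: m => [|m]; first by rewrite big_geq // mulr1 fact0 invr1.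
by rewrite big_ltn // addNr mul0r mulr0.
Qed.

(** Used with [u] and [v] the exponentials of [- w] and [- (y - w)], whose product is that of [- y],
    and [F] the Todd series of [y - w]. *)
Lemma blowup_quotient (R : comNzRingType) (F u v : R) :
  (1 - u * v - (1 - u)) * F = F * (1 - v) * (1 - (1 - u)).
Proof. by ring. Qed.

Lemma blowup_term (R : comNzRingType) (u v x y : R) :
  u * v * (x * y) = x * v * (u * y).
Proof. by ring. Qed.

Lemma blowup_cancel (R : comNzRingType) (t Y u z : R) n :
  t * Y = z -> Y ^+ n * u = z ^+ n -> z ^+ n * u = z ^+ n * t ^+ n.
Proof. by move=> <- uE; rewrite {1}exprMn -mulrA uE mulrC. Qed.

(** Write [Y ^+ c.+1] as [W ^+ c.+1] plus a difference of powers. The first hypothesis absorbs the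
    factor [Y - W] of the difference, the second turns [G ^+ c.+1 * W ^+ c.+1] into a power of
    [z]. *)
Lemma blowup_expand (R : comNzRingType) (Y W F G x z : R) c :
  (Y - W) * F = x * (1 - W) -> G * W = z ->
  Y ^+ c.+1 * (F * G ^+ c.+1) = z ^+ c.+1 * F +
    x * \sum_(k < c.+1) Y ^+ (c - k) * ((1 - W) * W ^+ k * G ^+ c.+1).
Proof.
move=> FE <-; rewrite exprMn.
transitivity (G ^+ c.+1 * W ^+ c.+1 * F
              + (Y ^+ c.+1 - W ^+ c.+1) * (F * G ^+ c.+1)); first by ring.
congr (_ + _); rewrite subrXX; set S := \sum_(i < _) _.
transitivity ((Y - W) * F * (S * G ^+ c.+1)); first by ring.
rewrite FE -!mulrA; congr (_ * _); rewrite mulr_suml mulr_sumr.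
by apply: eq_bigr => k _; ring.
Qed.

Section BlowUp.
Notation K := {poly {poly rat}}.
Let iota : {rmorphism rat -> K} := (polyC \o polyC : {rmorphism rat -> K}).
Let y : K := 'X%:P.
Let w : K := 'X.

(** The Todd factor of a blow-up along [c] divisors: [y - w] is the exceptional divisor and [w] the
    proper transforms. The variable [w] is the outer one, so that remainders modulo its powers have
    coefficients in [y]. *)
Definition blowup_todd (c : nat) : fps K :=
  fsub iota (y - w) toddS * fsub iota w toddS ^+ c.

(* The value at [w = y] of the remainder of [r] modulo [w ^+ c]. *)
Definition at_diag (c : nat) (r : K) : {poly rat} :=
  \sum_(k < c) r`_k * 'X^k.

Definition fapp (L : comNzRingType) (g : K -> L) (u : fps K) : fps L :=
  Fps (fun k => g (u k)).

Lemma fcoef_fapp (L : comNzRingType) (g : K -> L) u k : fapp g u k = g (u k).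
Proof. by []. Qed.

(** [at_diag] and the coefficient of [w ^+ c] are linear over polynomials in [y] but not
    multiplicative; series in [y] alone can still be pulled out of them. *)
Lemma fapp_scale (g : K -> {poly rat}) (v : fps {poly rat}) u :
  zmod_morphism g -> (forall a r, g (a%:P * r) = a * g r) ->
  fapp g (fsub polyC 1 v * u) = v * fapp g u.
Proof.
move=> gB gZ; have g0 : g 0 = 0 by rewrite -(subrr 0) gB subrr.
have gD r s : g (r + s) = g r + g s by rewrite -{2}[r](addrK s) gB subrK.
apply/fpsP => k; rewrite fcoef_fapp !fcoefM (big_morph g gD g0).
by apply: eq_bigr => i _; rewrite fcoef_fsub expr1n mulr1 gZ.
Qed.

Lemma at_diag_zmod c : zmod_morphism (at_diag c).
Proof.
move=> r s; rewrite /at_diag -sumrB; apply: eq_bigr => k _.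
by rewrite coefB mulrBl.
Qed.
HB.instance Definition _ c :=
  GRing.isZmodMorphism.Build K {poly rat} (at_diag c) (at_diag_zmod c).

Lemma at_diagZ c a r : at_diag c (a%:P * r) = a * at_diag c r.
Proof.
by rewrite /at_diag mulr_sumr; apply: eq_bigr => k _; rewrite coefCM mulrA.
Qed.

Lemma at_diagXM c r : at_diag c (w ^+ c * r) = 0.
Proof.
by rewrite /at_diag big1 // => k _; rewrite coefXnM ltn_ord mul0r.
Qed.

(** Setting [w = y] would kill a multiple of [y - w]; what survives is the opposite of the term of
    degree [c.+1] in [w] dropped by the remainder. *)
Lemma at_diag_sub c r : at_diag c.+1 ((y - w) * r) = 'X^(c.+1) * r`_c.
Proof.
rewrite mulrBl raddfB /= at_diagZ {1}/at_diag /at_diag big_ord_recr /= mulrDr.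
rewrite [X in _ - X]big_ord_recl coefXM /= mul0r add0r mulr_sumr.
rewrite addrAC -[RHS]add0r; congr (_ + _); last by rewrite mulrCA -exprS mulrC.
rewrite -sumrB big1 // => k _; rewrite coefXM /= mulrCA -exprS.
by rewrite /bump add1n subrr.
Qed.

(* The Todd class of a blow-up pushes forward to the Todd class of the base,
   when the centre is a complete intersection of [c] divisors of class [y] and
   the exceptional divisor has class [y - w]. *)
Lemma at_diag_blowup c m :
  at_diag c.+1 (blowup_todd c.+1 m) = (fsub polyC 'X toddS ^+ c.+1) m.
Proof.
pose Yp : fps {poly rat} := 1 - fsub polyC (- 'X) expS.
pose Y := fsub polyC 1 Yp : fps K.
pose W : fps K := 1 - fsub iota (- w) expS.
pose f a := fsub iota a toddS.
have YE : Y = 1 - fsub iota (- y) expS.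
  rewrite /Y rmorphB rmorph1 /= (@fsub_comp _ _ _ _ _ iota) // mulr1.
  by rewrite raddfN.
have fxE : (Y - W) * f (y - w) = cT (y - w) * (1 - W).
  rewrite -(td_expS iota) YE /W.
  have -> : - y = - w + - (y - w) by ring.
  by rewrite -expS_add; apply: blowup_quotient.
have fwE : f w * W = cT w by exact: td_expS.
pose D k : fps K :=
  fsub polyC 1 (Yp ^+ (c - k)) * ((1 - W) * W ^+ k * f w ^+ c.+1).
have DY k : D k = Y ^+ (c - k) * ((1 - W) * W ^+ k * f w ^+ c.+1).
  by rewrite /D rmorphXn.
(* Multiplying by the power of [Yp], a series in [y] only, makes the expansion possible; this power
   is removed at the end. *)
have main : fsub polyC 1 (Yp ^+ c.+1) * blowup_todd c.+1 =
    cT w ^+ c.+1 * f (y - w) + cT (y - w) * \sum_(k < c.+1) D k.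
  transitivity (Y ^+ c.+1 * (f (y - w) * f w ^+ c.+1)).
    by rewrite rmorphXn.
  apply: (etrans (blowup_expand c fxE fwE)).
  congr (_ + _ * _).
  by apply: eq_bigr => k _; rewrite DY.
(* Since [f w * W = cT w], the second factor of [D k] is a series [v] in the product of [w] and T.
   Its coefficient of [w ^+ c] is given by [expSN_todd_coef] and vanishes unless [k = c]. *)
have DE (k : 'I_c.+1) :
    fapp (coefp c) (D k) = if k == ord_max then cT 1 ^+ c else 0.
  rewrite /D fapp_scale; [|exact: raddfB|by move=> a r; apply: coefCM].
  pose v : fps rat := cT 1 ^+ k * (fsub idfun (-1) expS * toddS ^+ (c - k).+1).
  have -> : (1 - W) * W ^+ k * f w ^+ c.+1 = fsub iota w v.
    rewrite rmorphM rmorphM !rmorphXn /= fsub_cT rmorph1 mul1r -fwE.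
    rewrite (@fsub_comp _ _ _ _ _ iota) // rmorphN1 mulN1r /W subKr.
    rewrite exprMn -/(f w).
    have -> : f w ^+ c.+1 = f w ^+ k * f w ^+ (c - k).+1.
      by rewrite -exprD addnS subnKC // -ltnS.
    by apply: blowup_term.
  have vE j : fapp (coefp c) (fsub iota w v) j = (j == c)%:R * (v c)%:P.
    rewrite fcoef_fapp fcoef_fsub [LHS]/= coefCM coefXn eq_sym mulrC.
    by case: (j =P c) => [->|]; rewrite ?mul0r.
  have vc : v c = (k == ord_max)%:R.
    rewrite /v fcoef_cTXM -ltnS ltn_ord expr1n mul1r expSN_todd_coef.
    congr (nat_of_bool _)%:R.
    apply/idP/idP => [|/eqP ->]; last by rewrite subnn.
    by rewrite subn_eq0 -val_eqE /= eqn_leq => ->; rewrite -ltnS ltn_ord.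
  apply/fpsP => j; case: eqP => [kE|/eqP /negPf kE]; last first.
    by rewrite fcoefM big1 // => i _; rewrite vE vc kE mulr0 mulr0.
  rewrite kE subnn expr0 mul1r vE vc kE eqxx.
  by rewrite -[cT 1 ^+ c]mulr1 fcoef_cTXM expr1n mul1r fcoef1 subn_eq0
    polyC1 mulr1; case: ltngtP.
have SD : fapp (coefp c) (\sum_(k < c.+1) D k) = cT 1 ^+ c.
  transitivity (\sum_(k < c.+1) fapp (coefp c) (D k)).
    by apply/fpsP => j; rewrite fcoef_fapp !fcoef_sum raddf_sum.
  by rewrite (eq_bigr _ (fun k _ => DE k)) -big_mkcond big_pred1_eq.
(* The multiple of [w ^+ c.+1] has remainder 0, and [at_diag_sub] reduces the rest of [main] to the
   coefficients of [w ^+ c] found in [SD]. *)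
have fin : Yp ^+ c.+1 * fapp (at_diag c.+1) (blowup_todd c.+1) = cT 'X ^+ c.+1.
  rewrite -fapp_scale; [|exact: raddfB|exact: at_diagZ].
  rewrite main.
  transitivity (cT 'X^(c.+1) * fapp (coefp c) (\sum_(k < c.+1) D k)).
    apply/fpsP => j; rewrite fcoef_fapp fcoefD 2!fcoef_cTM fcoef_cTXM.
    have atD u v : at_diag c.+1 (u + v) = at_diag c.+1 u + at_diag c.+1 v.
      exact: raddfD.
    have at0 : at_diag c.+1 0 = 0 by exact: raddf0.
    rewrite atD; case: ifP => _; rewrite ?at_diagXM ?at0 add0r.
      by case: j => [|j]; rewrite ?at0 ?at_diag_sub.
    by case: j => [|j]; rewrite ?at0 ?at_diag_sub.
  rewrite SD; apply/fpsP => j.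
  rewrite fcoef_cTM -[in RHS](mulr1 (_ ^+ c.+1)) fcoef_cTXM fcoef1.
  case: j => [|j] //.
  rewrite -[cT 1 ^+ c]mulr1 fcoef_cTXM fcoef1 expr1n mul1r subSS.
  by rewrite ltnS; case: ifP => _; rewrite ?mulr0.
suff /fpsP /(_ m) : fapp (at_diag c.+1) (blowup_todd c.+1)
    = fsub polyC 'X toddS ^+ c.+1 by [].
have hX : GRing.lreg ('X : {poly rat}) by apply: mulfI; rewrite polyX_eq0.
apply: (cTX_inj (n := c.+1) hX).
exact: blowup_cancel (td_expS polyC 'X) fin.
Qed.

End BlowUp.

(** * Matroids and nested sets *)

Section MatroidTheory.
Variables (E : finType) (M : matroid E).
Implicit Types (A B F H K L : {set E}) (G S T : {set {set E}}).
Notation cl := (Defs.closure M).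

Lemma sub_closure A : A \subset cl A.
Proof.
by apply/subsetP => e eA; rewrite inE (setUidPr _) // sub1set.
Qed.

Lemma closureS A B : A \subset B -> cl A \subset cl B.
Proof.
move=> AB; apply/subsetP => e; rewrite !inE => /eqP eA.
rewrite eqn_leq [X in _ && X]rk_mono ?subsetUr // andbT.
have := rk_submod M (e |: A) B; rewrite eA -setUA (setUidPr AB) => le1.
have le2 : (rk M A <= rk M ((e |: A) :&: B))%N.
  by apply: rk_mono; rewrite subsetI subsetUr.
rewrite -(leq_add2r (rk M A)) (leq_trans _ (leq_trans le1 _)) ?leq_add2l //.
by rewrite addnC.
Qed.

(** Elements of the closure are added to [A] one at a time; each stays in the closure of the
    enlarged set by [closureS]. *)
Lemma rk_closure A : rk M (cl A) = rk M A.
Proof.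
have h (s : seq E) : {subset s <= cl A} -> rk M (A :|: [set e in s]) = rk M A.
  elim: s => [|e s IHs] sA; first by rewrite set_nil setU0.
  have {}IHs : rk M (A :|: [set e in s]) = rk M A.
    by apply: IHs => x xs; apply: sA; rewrite inE xs orbT.
  rewrite set_cons setUCA; have : e \in cl (A :|: [set e in s]).
    by apply: (subsetP (closureS (subsetUl _ _))); rewrite sA ?mem_head.
  by rewrite inE IHs => /eqP.
have := h (enum (cl A)); rewrite set_enum (setUidPr (sub_closure A)); apply.
by move=> x; rewrite mem_enum.
Qed.

Lemma closure_id A : cl (cl A) = cl A.
Proof.
apply/eqP; rewrite eqEsubset sub_closure andbT; apply/subsetP => e.
rewrite inE rk_closure => /eqP eA; rewrite inE eqn_leq -{1}eA.
by rewrite !rk_mono ?subsetUr // setUS // sub_closure.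
Qed.

Lemma closure_flat A : flat M (cl A).
Proof. by rewrite /flat closure_id. Qed.

Lemma closure_sub A F : flat M F -> A \subset F -> cl A \subset F.
Proof. by move=> /eqP {2}<- /closureS. Qed.

Lemma closure_between A B : A \subset B -> B \subset cl A -> cl B = cl A.
Proof.
move=> AB BA; apply/eqP; rewrite eqEsubset (closureS AB) andbT.
exact: closure_sub (closure_flat A) BA.
Qed.

Lemma rk_ltn A B : ~~ (B \subset cl A) -> (rk M A < rk M (A :|: B))%N.
Proof.
case/subsetPn=> e eB; rewrite inE => neA.
apply: (@leq_trans (rk M (e |: A))).
  by rewrite ltn_neqAle eq_sym neA [(_ <= _)%N]rk_mono ?subsetUr.
by apply: rk_mono; rewrite setUC setUS // sub1set.
Qed.

(** An independent subset of [A] of maximal size spans [A], since any element outside its closure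
    could be added. *)
Lemma exists_basis A :
  exists2 I : {set E}, I \subset A & (#|I| <= rk M A)%N /\ A \subset cl I.
Proof.
pose P (I : {set E}) := (I \subset A) && (rk M I == #|I|).
have P0 : P set0 by rewrite /P sub0set cards0 -leqn0 -(cards0 E) rk_card.
case: (@arg_maxnP _ set0 P (fun I : {set E} => #|I|) P0).
move=> I /andP[IA /eqP rI] Imax.
exists I => //; split; first by rewrite -rI rk_mono.
apply/subsetP => e eA; apply: contraT => neI.
have eI : e \notin I by apply: contra neI; apply/subsetP/sub_closure.
have := @rk_ltn I [set e]; rewrite sub1set => /(_ neI) lt1.
have PeI : P (e |: I).
  rewrite /P subUset sub1set eA IA /= eqn_leq rk_card /= cardsU1 eI add1n -rI.
  by rewrite setUC.
by have := Imax _ PeI; rewrite cardsU1 eI add1n /= ltnn.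
Qed.

Lemma nestedS G S T : T \subset S -> nested M G S -> nested M G T.
Proof.
move=> TS /andP[SG /forallP nS]; rewrite /nested (subset_trans TS SG) /=.
apply/forallP => U; apply/implyP => /and3P[UT U1 Ui].
by apply: (implyP (nS U)); rewrite (subset_trans UT TS) U1.
Qed.

Variable G : {set {set E}}.
Hypotheses (looplessM : loopless M) (buildG : building_set M G).

Lemma closure0 : cl set0 = set0.
Proof.
apply/setP => e; rewrite !inE setU0 looplessM.
have := rk_card M set0; rewrite cards0 leqn0 => /eqP->.
by [].
Qed.

Lemma building_flat F : F \in G -> flat M F.
Proof. by case: buildG => h _ /h[]. Qed.

Lemma building_neq0 F : F \in G -> F != set0.
Proof. by case: buildG => h _ /h[]. Qed.

Lemma mem_max_in F L : L \in max_in G F ->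
  [/\ L \in G, L \subset F
    & forall K, K \in G -> K \subset F -> L \subset K -> L = K].
Proof.
rewrite inE => /maxsetP[/andP[LG LF] Lmax]; split=> // K KG KF LK.
by apply/esym/Lmax; rewrite // KG.
Qed.

Lemma max_in_ex F H : H \in G -> H \subset F ->
  exists2 L, L \in max_in G F & H \subset L.
Proof.
move=> HG HF; have PH : (H \in G) && (H \subset F) by rewrite HG.
have [L Lmax HL] :=
  @maxset_exists _ (fun H => (H \in G) && (H \subset F)) H PH.
by exists L; rewrite ?inE.
Qed.

(** Injectivity of the join map, freed from the encoding of the product by finite functions extended
    by [set0]. *)
Lemma interval_prod_inj F (g h : {set E} -> {set E}) :
  flat M F -> F != set0 ->
  (forall L, L \in max_in G F -> flat M (g L) && (g L \subset L)) ->
  (forall L, L \in max_in G F -> flat M (h L) && (h L \subset L)) ->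
  cl (\bigcup_(L in max_in G F) g L) = cl (\bigcup_(L in max_in G F) h L) ->
  {in max_in G F, g =1 h}.
Proof.
move=> flatF F0; case: buildG => _ /(_ F flatF F0) [inj _ _].
pose x g : {ffun {set E} -> {set E}} :=
  [ffun L => if L \in max_in G F then g L else set0].
have inx k : (forall L, L \in max_in G F -> flat M (k L) && (k L \subset L)) ->
    x k \in interval_prod M G F.
  move=> kP; apply/pfamilyP; split; last by move=> L LF; rewrite ffunE LF inE kP.
  by apply/subsetP => L; rewrite supportE ffunE; case: ifP => //; rewrite eqxx.
have joinx k : join_map M G F (x k) = cl (\bigcup_(L in max_in G F) k L).
  congr (Defs.closure M _); apply/setP => i; apply/bigcupP/bigcupP.
    by case=> _ /imsetP[L LF ->]; rewrite ffunE LF => iL; exists L.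
  by case=> L LF iL; exists (k L) => //; apply/imsetP; exists L; rewrite // ffunE LF.
move=> gP hP; rewrite -!joinx => /(inj _ _ (inx g gP) (inx h hP)) /ffunP eqgh L LF.
by have := eqgh L; rewrite !ffunE LF.
Qed.

(** The set [H] lies in a maximal element [L] of [G] below the join [J]. By uniqueness of the
    decomposition of [J], the maximal members of [S] below [L] join to [L]; nestedness leaves only
    one of them, equal to [L]. *)
Lemma join_nested_sub S H : nested M G S -> H \in G -> H \subset join M S ->
  exists2 K, K \in S & H \subset K.
Proof.
move=> nS HG HJ; set J := join M S in HJ.
have SG K : K \in S -> K \in G.
  by case/andP: nS => /subsetP h _ /h; rewrite inE => /andP[].
pose T := [set K | maxset (mem S) K].
have TS K : K \in T -> K \in S by rewrite inE => /maxsetP[].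
have ST K : K \in S -> exists2 K', K' \in T & K \subset K'.
  move=> KS; have [K' ? ?] := maxset_exists (P := mem S) KS.
  by exists K'; rewrite ?inE.
have subJ K : K \in S -> K \subset J.
  by move=> KS; apply: subset_trans (sub_closure _); apply: bigcup_sup.
have J0 : J != set0.
  by apply: contraNneq (building_neq0 HG) => J0; rewrite -subset0 -J0.
pose TL L := [set K in T | K \subset L].
(* Each member of [T] lies below some [L], so these [g L] still join to [J]. This is applied to
   [g L = join M (TL L)] and to [g L = L]. *)
have JE (g : {set E} -> {set E}) :
    (forall L, L \in max_in G J -> g L \subset J /\
       forall K, K \in T -> K \subset L -> K \subset g L) ->
    cl (\bigcup_(L in max_in G J) g L) = J.
  move=> gP; apply: closure_between.
    apply/bigcupsP => K /ST[K' K'T] /subset_trans; apply.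
    have [L LJ K'L] := max_in_ex (SG _ (TS _ K'T)) (subJ _ (TS _ K'T)).
    by apply: (subset_trans _ (bigcup_sup L LJ)); apply: (gP L LJ).2.
  by apply/bigcupsP => L /gP[].
have joinTL L : L \in max_in G J -> join M (TL L) = L.
  move=> LJ; have [LG LsJ _] := mem_max_in LJ.
  apply: (@interval_prod_inj J (fun K => join M (TL K)) id) LJ => //.
  - exact: closure_flat.
  - move=> K /mem_max_in[KG _ _]; rewrite closure_flat /=.
    apply: closure_sub (building_flat KG) _.
    by apply/bigcupsP => K'; rewrite inE => /andP[].
  - by move=> K /mem_max_in[KG _ _]; rewrite subxx building_flat.
  rewrite !JE // => K /mem_max_in[KG KJ _] //; split; last first.
    move=> K' K'T K'K; apply: subset_trans (sub_closure _).
    by apply: bigcup_sup; rewrite inE K'T.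
  apply: closure_sub (closure_flat _) _; apply/bigcupsP => K'.
  by rewrite inE => /andP[/TS /subJ].
have [L LJ HL] := max_in_ex HG HJ; have [LG _ _] := mem_max_in LJ.
have LE := joinTL L LJ.
(* With no member below it [L] would be empty; with two or more, their join [L] would lie in [G],
   against nestedness. *)
case: (ltngtP #|TL L| 1) => [| T1 |/eqP/cards1P[K KE]].
- rewrite ltnS leqn0 cards_eq0 => /eqP T0.
  by have := building_neq0 LG; rewrite -LE T0 /join big_set0 closure0 eqxx.
- case/andP: nS => _ /forallP /(_ (TL L)); rewrite T1 LE LG implybF.
  case/negP; rewrite /=; apply/andP; split.
    by apply/subsetP => K; rewrite inE => /andP[/TS].
  apply/forallP => K; apply/implyP; rewrite inE => /andP[KT _].
  apply/forallP => K'; apply/implyP; rewrite inE => /andP[K'T _].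
  apply/implyP => KK'; move: KT; rewrite inE => /maxsetP[_ h].
  by rewrite [K'](h _ (TS _ K'T) KK').
have : K \in TL L by rewrite KE set11.
rewrite inE => /andP[/TS KS _]; exists K => //.
rewrite -LE KE /join big_set1 in HL.
exact: subset_trans HL (closure_sub (building_flat (SG _ KS)) (subxx K)).
Qed.

Lemma nested_sub S K : nested M G S -> K \in S -> K \in G.
Proof. by case/andP=> /subsetP h _ /h; rewrite inE => /andP[]. Qed.

Lemma nested_neqT S : nested M G S -> [set: E] \notin S.
Proof. by case/andP=> /subsetP h _; apply/negP => /h; rewrite !inE eqxx. Qed.

(** Incomparable members [A] and [B] are maximal elements of [G] below their join, by
    [join_nested_sub]. For a common element [i], putting the closure of [i] in the factor of [A] or
    in that of [B] gives the same join, against injectivity. *)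
Lemma nested_laminar S A B : nested M G S -> A \in S -> B \in S ->
  [|| A \subset B, B \subset A | [disjoint A & B]].
Proof.
move=> nS AS BS; case: (boolP (A \subset B)) => //= nAB.
case: (boolP (B \subset A)) => //= nBA.
pose J := join M [set A; B].
have AB_S : [set A; B] \subset S by rewrite subUset !sub1set AS.
have subJ K : K \in [set A; B] -> K \subset J.
  by move=> KAB; apply: subset_trans (sub_closure _); apply: bigcup_sup.
have maxJ K : K \in [set A; B] -> K \in max_in G J.
  move=> KAB; have KG := nested_sub nS (subsetP AB_S _ KAB).
  have [L LJ KL] := max_in_ex KG (subJ _ KAB); have [LG LsJ _] := mem_max_in LJ.
  have [K' K'AB LK'] := join_nested_sub (nestedS AB_S nS) LG LsJ.
  suff KK' : K = K' by rewrite (_ : K = L) //; apply/eqP; rewrite eqEsubset KL KK'.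
  have := subset_trans KL LK'; move: KAB K'AB; rewrite !inE.
  by case/orP=> /eqP-> /orP[] /eqP-> //; rewrite (negPf nAB, negPf nBA).
apply/pred0P => i /=; apply/negP => /andP[iA iB].
have ci0 : i \in cl [set i] by apply: (subsetP (sub_closure _)); rewrite inE.
have AJ : A \in max_in G J by apply: maxJ; rewrite !inE eqxx.
have BJ : B \in max_in G J by apply: maxJ; rewrite !inE eqxx orbT.
have J0 : J != set0.
  by apply/set0Pn; exists i; apply: (subsetP (subJ A _)); rewrite ?inE ?eqxx.
pose g C K := if K == C then cl [set i] else set0.
have gP C L : C \in max_in G J -> i \in C -> L \in max_in G J ->
    flat M (g C L) && (g C L \subset L).
  move=> /mem_max_in[CG _ _] iC _; rewrite /g; case: eqP => [->|_].
    by rewrite closure_flat closure_sub ?building_flat ?sub1set.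
  by rewrite sub0set andbT /flat closure0.
have gU C : C \in max_in G J -> \bigcup_(L in max_in G J) g C L = cl [set i].
  move=> CJ; rewrite (bigD1 C) //= /g eqxx big1 ?setU0 // => L /andP[_ /negPf->].
  by [].
have /(_ A AJ) : {in max_in G J, g A =1 g B}.
  apply: interval_prod_inj => //; first exact: closure_flat.
  - by move=> L; apply: gP.
  - by move=> L; apply: gP.
  by rewrite !gU.
rewrite /g eqxx; case: eqP => [AB|_ c0]; first by rewrite AB subxx in nAB.
by rewrite c0 inE in ci0.
Qed.

Hypothesis GT : [set: E] \in G.

(* The linear form [e_i - e_j] vanishes on the rays of the cone of [S] other
   than that of [H]. *)
Lemma nested_separation S H : nested M G S -> H \in S ->
  exists i j : E, [/\ i \in H, j \notin H,
    forall K, K \in S -> K != H -> (i \in K) = (j \in K)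
  & forall K, K \in S -> ~~ (H \subset K) -> i \notin K].
Proof.
move=> nS HS; have HG := nested_sub nS HS.
(* The members of [S] properly inside [K] do not cover [K], by [join_nested_sub]. *)
have sep K : K \in G -> exists2 i, i \in K &
    forall L, L \in S -> L \proper K -> i \notin L.
  move=> KG; pose S' := [set L in S | L \proper K].
  have S'S : S' \subset S by apply/subsetP => L; rewrite inE => /andP[].
  have : ~~ (K \subset join M S').
    apply/negP => /(join_nested_sub (nestedS S'S nS) KG)[L].
    by rewrite inE properE => /andP[_ /andP[_ /negPf->]].
  case/subsetPn=> i iK niJ; exists i => // L LS LK; apply: contra niJ => iL.
  apply: (subsetP (sub_closure _)); apply/bigcupP; exists L => //.
  by rewrite inE LS.
have [i iH iP] := sep H HG.
have iN K : K \in S -> ~~ (H \subset K) -> i \notin K.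
  move=> KS nHK; case/or3P: (nested_laminar nS KS HS) => [KH||dis].
  - by apply: iP => //; rewrite properE KH.
  - by rewrite (negPf nHK).
  by apply/negP => iK; move/pred0P: dis => /(_ i) /=; rewrite iK iH.
(* The element [j] is chosen in a minimal [K] properly containing [H], among [S] and the ground set,
   and outside the smaller members; laminarity then compares [i] and [j] in every other member. *)
pose P (K : {set E}) := (K \in [set: E] |: S) && (H \proper K).
have PT : P [set: E].
  rewrite /P !inE eqxx properT /=; apply: contraNneq (nested_neqT nS) => <-.
  by [].
have [K /minsetP[/andP[KS HK] Kmin] _] := minset_exists PT.
have lam L j : L \in S -> j \in L -> j \in K -> (L \subset K) || (K \subset L).
  move=> LS jL jK; move: KS; rewrite !inE => /predU1P[->|KS].
    by rewrite subsetT.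
  case/or3P: (nested_laminar nS LS KS) => [-> //|->|dis]; first by rewrite orbT.
  by move/pred0P: dis => /(_ j) /=; rewrite jL jK.
have KG : K \in G.
  by move: KS; rewrite !inE => /predU1P[->|/(nested_sub nS)].
have [j jK jP] := sep K KG.
exists i, j; split=> // [|L LS LH]; first exact: jP.
case: (boolP (H \subset L)) => [HL|nHL].
  have iL := subsetP HL i iH; rewrite iL; apply/esym.
  have iK : i \in K by apply: (subsetP (proper_sub HK)).
  case/orP: (lam L i LS iL iK) => [LK|/subsetP-> //].
  suff -> : L = K by [].
  by apply: Kmin; rewrite // /P !inE LS orbT properEneq eq_sym LH.
rewrite (negPf (iN L LS nHL)); apply/esym/negP => jL.
case/orP: (lam L j LS jL jK) => [LK|KL]; last first.
  by rewrite (subset_trans (proper_sub HK) KL) in nHL.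
case: (eqVneq L K) => [LK'|nLK]; first by rewrite LK' (proper_sub HK) in nHL.
by have := jP L LS; rewrite properEneq nLK LK jL => /(_ isT).
Qed.

(** Adding the members of [S :\: S0] by removing maximal ones in turn, each step raises the rank,
    since by [join_nested_sub] a member is not in the closure of others that do not contain it. The
    ground set, also in [G], gives the last strict step. *)
Lemma nested_rk S0 S : nested M G S -> S0 \subset S ->
  (forall K L, K \in S :\: S0 -> L \in S0 -> ~~ (K \subset L)) ->
  (rk M (\bigcup_(K in S0) K) + #|S :\: S0| < rk M [set: E])%N.
Proof.
move=> nS S0S SP.
have main n : forall T, nested M G T -> S0 \subset T -> #|T :\: S0| = n ->
    (forall K L, K \in T :\: S0 -> L \in S0 -> ~~ (K \subset L)) ->
    (rk M (\bigcup_(K in S0) K) + n <= rk M (\bigcup_(K in T) K))%N.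
  elim: n => [|n IHn] T nT S0T cT TP.
    rewrite addn0 rk_mono //; apply/bigcupsP => K KS0; apply: bigcup_sup.
    exact: (subsetP S0T).
  have /card_gt0P[K0 K0P] : (0 < #|T :\: S0|)%N by rewrite cT.
  have [K /maxsetP[KT Kmax] _] := maxset_exists (P := mem (T :\: S0)) K0P.
  rewrite /= in KT Kmax; have := KT; rewrite inE => /andP[KS0 KinT].
  have T'T : T :\ K \subset T by apply: subD1set.
  have nT' := nestedS T'T nT.
  have lt1 : ~~ (K \subset cl (\bigcup_(L in T :\ K) L)).
    apply/negP => /(join_nested_sub nT' (nested_sub nT KinT))[L].
    rewrite !inE => /andP[LK LT] KL; case: (boolP (L \in S0)) => [LS0|LS0].
      by have := TP K L KT LS0; rewrite KL.
    by case/eqP: LK; apply: Kmax KL; rewrite inE LS0.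
  have S0T' : S0 \subset T :\ K.
    apply/subsetP => L LS0; rewrite !inE (subsetP S0T _ LS0) andbT.
    by apply: contraNneq KS0 => <-.
  have T'E : (T :\ K) :\: S0 = (T :\: S0) :\ K.
    by apply/setP => L; rewrite !inE; case: (L \in S0); rewrite /= ?andbF // .
  have cT' : #|(T :\ K) :\: S0| = n.
    by rewrite T'E; apply/succn_inj; rewrite -cT (cardsD1 K (T :\: S0)) KT.
  have TP' L L' : L \in (T :\ K) :\: S0 -> L' \in S0 -> ~~ (L \subset L').
    by rewrite T'E inE => /andP[_ /TP]; apply.
  rewrite addnS; apply: leq_trans (leq_trans (rk_ltn lt1) _); last first.
    apply: rk_mono; rewrite subUset andbC bigcup_sup //=.
    by apply/bigcupsP => L /(subsetP T'T) LT; apply: bigcup_sup.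
  by rewrite ltnS IHn.
apply: leq_ltn_trans (main _ S nS S0S erefl SP) _.
have ltT : ~~ ([set: E] \subset cl (\bigcup_(K in S) K)).
  apply/negP => /(join_nested_sub nS GT)[K KS]; rewrite subTset => /eqP KT.
  by have := nested_neqT nS; rewrite -KT KS.
by apply: leq_trans (rk_ltn ltT) _; rewrite rk_mono ?subsetT.
Qed.

Lemma building_rk_gt0 F : F \in G -> (0 < rk M F)%N.
Proof.
move=> FG; have /set0Pn[i iF] := building_neq0 FG.
by rewrite -(looplessM i) rk_mono // sub1set.
Qed.

End MatroidTheory.

(** * Vanishing of monomials in the Chow ring *)

(** A monomial is a multiple of the squarefree one with the same support, to which the non-nested
    relations apply. *)
Lemma prod_seq_set (R : comNzRingType) (I : finType) (x : I -> R) (s : seq I) :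
  exists c, \prod_(i <- s) x i = \prod_(i in [set i in s]) x i * c.
Proof.
elim: s => [|h s [c IHs]].
  by exists 1; rewrite set_nil big_nil big_set0 mulr1.
rewrite big_cons IHs set_cons; case: (boolP (h \in s)) => hs.
  rewrite (setUidPr _) ?sub1set ?inE //.
  by exists (x h * c); rewrite mulrCA.
by exists c; rewrite big_setU1 ?inE //= mulrA.
Qed.

Lemma not_uniq_rem (T : eqType) (s : seq T) :
  ~~ uniq s -> exists2 h, h \in s & h \in rem h s.
Proof.
elim: s => //= a s IHs; rewrite negb_and negbK.
case: (boolP (a \in s)) => [sa _|sa /= /IHs[h hs hr]].
  by exists a; rewrite ?mem_head // eqxx.
exists h; first by rewrite inE hs orbT.
by case: eqP sa => [->|_ _]; [rewrite hs | rewrite inE hr orbT].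
Qed.

Section ChowRing.
Variables (E : finType) (M : matroid E) (G : {set {set E}}).
Hypotheses (looplessM : loopless M) (buildG : building_set M G).
Hypothesis GT : [set: E] \in G.
Notation n := (ndiv G).
Notation A := (Chow M G rat).
Notation r := (rk M [set: E]).
Notation d := r.-1.

Definition chow_mor : {rmorphism {mpoly rat[n]} -> A} := \pi_(Chow M G rat)%qT.
Definition chow_var (i : 'I_n) : A := chow_mor 'X_i.
Definition chow_const (c : rat) : A := chow_mor c%:MP.

Lemma chow_const_zmod : zmod_morphism chow_const.
Proof. by move=> a b; rewrite /chow_const !rmorphB. Qed.
Lemma chow_const_monoid : monoid_morphism chow_const.
Proof. by split=> [|a b]; rewrite /chow_const ?rmorph1 ?rmorphM. Qed.
HB.instance Definition _ :=
  GRing.isZmodMorphism.Build rat A chow_const chow_const_zmod.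
HB.instance Definition _ :=
  GRing.isMonoidMorphism.Build rat A chow_const chow_const_monoid.

Arguments chow_mor : simpl never.
Notation x := chow_var.
Notation kappa := chow_const.

Lemma chow_scalE c (a : A) : scal c a = kappa c * a.
Proof. by []. Qed.

Lemma chow_mor_rel p : chow_rel M p -> chow_mor p = 0.
Proof.
move=> Pp; rewrite -(rmorph0 chow_mor).
by apply/chow_pi_eq; rewrite subr0; apply: gen_ideal_gen.
Qed.

Lemma chow_SR (S : {set 'I_n}) :
  ~~ nested M G [set divF i | i in S] -> \prod_(i in S) x i = 0.
Proof.
move=> nS; rewrite -(chow_mor_rel (Chow_SR rat nS)).
by rewrite (rmorph_prod chow_mor).
Qed.

Lemma chow_SR_seq (S : {set 'I_n}) (s : seq 'I_n) :
  ~~ nested M G [set divF i | i in S :|: [set i in s]] ->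
  \prod_(i in S) x i * \prod_(i <- s) x i = 0.
Proof.
move=> nS; rewrite -[X in X * _]big_enum -big_cat /=.
have [c ->] := prod_seq_set x (enum S ++ s).
rewrite (_ : [set i in _] = S :|: [set i in s]) ?chow_SR ?mul0r //.
by apply/setP => i; rewrite !inE mem_cat mem_enum.
Qed.

Lemma chow_lin (e f : E) :
  \sum_(i | e \in divF i) x i = \sum_(i | f \in divF i) x i.
Proof.
have := chow_mor_rel (Chow_lin M G rat e f).
rewrite (rmorphB chow_mor) !(rmorph_sum chow_mor) => /eqP.
by rewrite subr_eq0 => /eqP.
Qed.

Lemma divF_inj : injective (@divF E G).
Proof. exact: enum_val_inj. Qed.

Lemma divF_mem (i : 'I_n) : divF i \in G.
Proof. by have := enum_valP i; rewrite inE => /andP[]. Qed.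

Lemma divF_neqT (i : 'I_n) : divF i != [set: E].
Proof. by have := enum_valP i; rewrite !inE => /andP[]. Qed.

(* If a variable [x h] is repeated in [s], a linear relation separating [h]
   from the rest of the support replaces it by variables outside the support;
   squarefree monomials are handled by [nested_rk]. *)
Lemma chow_vanish (S0 : {set 'I_n}) (s : seq 'I_n) :
  (forall h f, h \in s -> f \in S0 -> ~~ (divF h \subset divF f)) ->
  (r <= rk M (\bigcup_(f in S0) divF f) + size s)%N ->
  \prod_(i in S0) x i * \prod_(i <- s) x i = 0.
Proof.
(* Induction on the number of variables outside the support of [s]. *)
have [m] := ubnP (n - #|[set i in s]|); elim: m s => // m IHm s ltm sP ler.
pose S := [set divF i | i in S0 :|: [set i in s]].
case: (boolP (nested M G S)) => [nS|]; last exact: chow_SR_seq.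
have SP i : i \in s -> divF i \in S.
  by move=> si; apply/imset_f; rewrite !inE si orbT.
have S0P f : f \in S0 -> divF f \in S by move=> Sf; apply/imset_f; rewrite inE Sf.
case: (boolP (uniq s)) => [us|].
  pose S0' := [set divF i | i in S0].
  have S0S : S0' \subset S by apply: imsetS; apply: subsetUl.
  have SDE : S :\: S0' = [set divF i | i in [set i in s]].
    apply/setP => K; rewrite inE; apply/andP/imsetP.
      case=> KS0 /imsetP[i]; rewrite inE => /orP[iS0|si] KE; last by exists i.
      by case/negP: KS0; rewrite KE imset_f.
    case=> i; rewrite inE => si ->; split; last exact: SP.
    apply/negP => /imsetP[f fS0 if_].
    by have := sP i f si fS0; rewrite if_ subxx.
  have /(nested_rk looplessM buildG GT nS S0S) : forall K L,
      K \in S :\: S0' -> L \in S0' -> ~~ (K \subset L).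
    rewrite SDE => K L /imsetP[i]; rewrite inE => si -> /imsetP[f fS0 ->].
    exact: sP.
  have UE : \bigcup_(K in S0') K = \bigcup_(f in S0) divF f.
    by rewrite /S0' big_imset //= => i j _ _; apply: divF_inj.
  rewrite UE SDE card_imset; last exact: divF_inj.
  by rewrite cardsE (card_uniqP us) ltnNge ler.
case/not_uniq_rem => h hs hr; set s' := rem h s in hr.
have [i [j [ih jh ij iN]]] := nested_separation looplessM buildG GT nS (SP h hs).
pose Z := \prod_(i in S0) x i * \prod_(i <- s') x i.
have -> : \prod_(i in S0) x i * \prod_(i <- s) x i = x h * Z.
  by rewrite (perm_big _ (perm_to_rem hs)) big_cons mulrCA.
have s'E k : (k \in s) = (k \in h :: s') by rewrite (perm_mem (perm_to_rem hs)).
(* Replacing one copy of [h] by [K] keeps the degree and enlarges the support, because [h] is still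
   in [s']. A set of [S0] contains neither [i] nor [j], so it cannot contain [divF K]. *)
have K0 K : K != h -> (i \in divF K) != (j \in divF K) -> x K * Z = 0.
  move=> Kh Kij.
  have -> : x K * Z = \prod_(i in S0) x i * \prod_(i <- K :: s') x i.
    by rewrite big_cons mulrCA.
  have KS : K \notin S0 :|: [set i in s].
    apply/negP => KS; case/negP: Kij; apply/eqP/ij; first exact: imset_f.
    by rewrite (inj_eq divF_inj).
  have setE : [set i in K :: s'] = K |: [set i in s].
    apply/setP => k; rewrite !inE s'E inE.
    by case: (k =P h) => [->|]; rewrite ?hr ?orbT.
  apply: IHm.
  - have /negPf KsF : K \notin [set i in s].
      by apply: contra KS => ?; rewrite inE; apply/orP; right.
    apply: leq_trans _ (ltm : (_ <= m)%N); rewrite setE cardsU1 KsF add1n.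
    have : (#|K |: [set i in s]| <= n)%N.
      by rewrite -[X in (_ <= X)%N]card_ord max_card.
    by rewrite cardsU1 KsF add1n; move/subnSK => ->.
  - move=> k f; rewrite inE => /predU1P[->|ks'] fS0; last first.
      by apply: sP => //; rewrite s'E inE ks' orbT.
    have hf := sP h f hs fS0.
    have if_ := iN _ (S0P f fS0) hf.
    have jf : j \notin divF f.
      rewrite -(ij _ (S0P f fS0)) //; apply: contraNneq hf => ->.
      by rewrite subxx.
    apply: contra Kij => /subsetP Kf; apply/eqP.
    by rewrite (contraNF (Kf i) if_) (contraNF (Kf j) jf).
  by rewrite (perm_size (perm_to_rem hs)) /= in ler.
(* In the relation for [i] and [j] times [Z], sets other than [divF h] containing just one of them
   contribute 0, those containing both cancel, and only [x h * Z] is left. *)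
have /(congr1 (fun a => a * Z)) := chow_lin i j.
rewrite !mulr_suml (bigD1 h) //= (bigID (fun K => j \in divF K)) /=.
rewrite [X in _ + (_ + X)]big1 ?addr0; last first.
  by move=> K /andP[/andP[iK Kh] jK]; apply: K0; rewrite // iK (negPf jK).
rewrite [in RHS](bigID (fun K => i \in divF K)) /=.
rewrite [X in _ = _ + X]big1 ?addr0; last first.
  move=> K /andP[jK iK]; apply: K0; last by rewrite jK (negPf iK).
  by apply: contraNneq iK => ->.
set a := \sum_(K | _) _; set b := \sum_(K | _) _.
suff -> : a = b by move/(canRL (addrK _)); rewrite subrr.
apply: eq_bigl => K; rewrite andbC; case: (boolP (j \in _)) => //= jK.
by rewrite andb_idr // => _; apply: contraNneq jh => <-.
Qed.

End ChowRing.

Arguments chow_mor : simpl never.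

(** * Graded pieces of the Chow ring *)

Section ChowGrading.
Variables (E : finType) (M : matroid E) (G : {set {set E}}).
Hypotheses (looplessM : loopless M) (buildG : building_set M G).
Hypothesis GT : [set: E] \in G.
Notation n := (ndiv G).
Notation A := (Chow M G rat).
Notation r := (rk M [set: E]).
Notation d := r.-1.
Notation x := (@chow_var E M G).
Notation kappa := (@chow_const E M G).
Notation clA := (@Cl E M G rat).

Lemma ClE (D : Div G) : clA D = \sum_i kappa (D i)%:~R * x i.
Proof.
transitivity (chow_mor M G (\sum_i (D i)%:~R *: 'X_i)); first by [].
rewrite rmorph_sum; apply: eq_bigr => i _.
by rewrite -mul_mpolyC rmorphM.
Qed.

Lemma Cl_zmod : zmod_morphism clA.
Proof.
move=> D D'; rewrite !ClE -sumrB; apply: eq_bigr => i _.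
by rewrite !ffunE mulrzBr (rmorphB kappa) mulrBl.
Qed.
HB.instance Definition _ := GRing.isZmodMorphism.Build (Div G) A clA Cl_zmod.

Lemma Cl_xdiv (i : 'I_n) : clA (xdiv i) = x i.
Proof.
rewrite ClE (bigD1 i) //= big1 => [|j /negPf ji].
  by rewrite !ffunE eqxx rmorph1 mul1r addr0.
by rewrite !ffunE ji rmorph0 mul0r.
Qed.

Lemma Cl_alphaE e : clA (alpha G e) = \sum_(i | e \in divF i) x i.
Proof. by rewrite raddf_sum; apply: eq_bigr => i _; apply: Cl_xdiv. Qed.

(** Once alpha is represented by a point of [divF i], it contains every variable subtracted in
    [theta]. *)
Lemma Cl_thetaE e (i : 'I_n) a : a \in divF i ->
  clA (theta e i) = \sum_(j | (a \in divF j) && ~~ (divF i \subset divF j)) x j.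
Proof.
move=> ai; rewrite (raddfB clA) /= (Cl_alpha M G rat e a) Cl_alphaE.
rewrite raddf_sum (bigID (fun j => divF i \subset divF j)) /=.
rewrite addrAC -[RHS]add0r; congr (_ + _).
rewrite -[RHS](subrr (\sum_(j | divF i \subset divF j) x j)).
congr (_ - _); last by apply: eq_bigr => j _; apply: Cl_xdiv.
by apply: eq_bigl => j; rewrite andb_idl // => /subsetP->.
Qed.

(** Expand with one representative for each element of a basis of [divF i]. The support of each
    monomial covers the basis, so its join contains [divF i] while none of its members does; by
    [join_nested_sub] it is not nested. *)
Lemma theta_nilp e (i : 'I_n) : clA (theta e i) ^+ rk M (divF i) = 0.
Proof.
have [I IF [cI FI]] := exists_basis M (divF i).
rewrite -(subnK cI) exprD -[X in _ * X]prodr_const.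
rewrite (eq_bigr (fun a =>
  \sum_(j | (a \in divF j) && ~~ (divF i \subset divF j)) x j)).
  rewrite (big_distr_big_dep i) big1 /= ?mulr0 // => f /pfamilyP[_ fP].
  have -> : \prod_(a in I) x (f a) = \prod_(j <- [seq f a | a <- enum I]) x j.
    by rewrite big_map big_enum.
  have := @chow_SR_seq E M G set0 [seq f a | a <- enum I].
  rewrite big_set0 mul1r; apply; apply/negP => nS.
  have := join_nested_sub looplessM buildG nS (divF_mem i); case.
    apply: subset_trans FI _; apply: closureS; apply/subsetP => a aI.
    have /andP[afa _] := fP a aI.
    apply/bigcupP; exists (divF (f a)) => //; apply: imset_f.
    by rewrite !inE map_f // mem_enum.
  move=> K /imsetP[j]; rewrite !inE /= => /mapP[a]; rewrite mem_enum => aI -> ->.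
  by have /andP[_ /negPf->] := fP a aI.
by move=> a /(subsetP IF) /Cl_thetaE.
Qed.

(** The degree [k] part of the subalgebra generated by the variables of [V]. The explicit list of
    terms lets vanishing results be applied monomial by monomial. *)
Definition span (V : pred 'I_n) (k : nat) (a : A) : Prop :=
  exists2 L : seq (rat * seq 'I_n),
    all (fun cs => (size cs.2 == k) && all V cs.2) L &
    a = \sum_(cs <- L) kappa cs.1 * \prod_(i <- cs.2) x i.

Section Span.
Variable V : pred 'I_n.

Lemma span0 k : span V k 0.
Proof. by exists [::]; rewrite ?big_nil. Qed.

Lemma spanD k a b : span V k a -> span V k b -> span V k (a + b).
Proof.
move=> [L LP ->] [L' LP' ->]; exists (L ++ L'); first by rewrite all_cat LP.
by rewrite big_cat.
Qed.

Lemma span_const c : span V 0 (kappa c).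
Proof.
by exists [:: (c, [::])] => //; rewrite big_seq1 big_nil mulr1.
Qed.

Lemma span_var i : V i -> span V 1 (x i).
Proof.
by move=> Vi; exists [:: (1, [:: i])]; rewrite /= ?Vi // !big_seq1 rmorph1 mul1r.
Qed.

Lemma spanM k l a b : span V k a -> span V l b -> span V (k + l) (a * b).
Proof.
move=> [L /allP LP ->] [L' /allP LP' ->].
exists [seq (p.1.1 * p.2.1, p.1.2 ++ p.2.2) | p <- [seq (p, q) | p <- L, q <- L']].
  rewrite all_map; apply/allP => cs /allpairsP[[p q] /=].
  case=> /LP/andP[/eqP sp Vp] /LP'/andP[/eqP sq Vq] ->.
  by rewrite /= size_cat sp sq eqxx all_cat Vp.
rewrite big_map big_allpairs /= mulr_suml; apply: eq_bigr => p _.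
rewrite mulr_sumr; apply: eq_bigr => q _ /=.
by rewrite (rmorphM kappa) big_cat mulrACA.
Qed.

Lemma spanZ c k a : span V k a -> span V k (kappa c * a).
Proof. exact: spanM (span_const c). Qed.

Lemma spanN k a : span V k a -> span V k (- a).
Proof. by move/(spanZ (-1)); rewrite rmorphN1 mulN1r. Qed.

Lemma span_sum k (I : Type) (s : seq I) (P : pred I) (F : I -> A) :
  (forall i, P i -> span V k (F i)) -> span V k (\sum_(i <- s | P i) F i).
Proof. by move=> FP; apply: big_ind => //; [exact: span0 | exact: spanD]. Qed.

Lemma span1 : span V 0 1.
Proof. by have := span_const 1; rewrite rmorph1. Qed.

Lemma spanX a k m : span V k a -> span V (k * m) (a ^+ m).
Proof.
move=> Va; elim: m => [|m IHm]; first by rewrite muln0; apply: span1.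
by rewrite mulnS exprS; apply: spanM.
Qed.

Definition graded (u : fps A) : Prop := forall k, span V k (u k).

Lemma graded1 : graded 1.
Proof. by case=> [|k]; [apply: span1 | apply: span0]. Qed.

Lemma gradedM u v : graded u -> graded v -> graded (u * v).
Proof.
move=> uP vP k; rewrite fcoefM; apply: span_sum => i _.
by have := spanM (uP i) (vP (k - i)%N); rewrite subnKC // -ltnS.
Qed.

Lemma gradedX u m : graded u -> graded (u ^+ m).
Proof.
move=> uP; elim: m => [|m IHm]; first exact: graded1.
by rewrite exprS; apply: gradedM.
Qed.

Lemma graded_prod (I : Type) (s : seq I) (P : pred I) (F : I -> fps A) :
  (forall i, P i -> graded (F i)) -> graded (\prod_(i <- s | P i) F i).
Proof. by move=> FP; apply: big_ind => //; [exact: graded1 | exact: gradedM]. Qed.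

Lemma graded_fsub a u : span V 1 a -> graded (fsub kappa a u).
Proof.
by move=> aP k; have := spanX k aP; rewrite mul1n => /(spanZ (u k)).
Qed.

End Span.

Lemma span_sub (V V' : pred 'I_n) k a :
  {subset V <= V'} -> span V k a -> span V' k a.
Proof.
move=> VV' [L LP ->]; exists L => //; apply: sub_all LP => cs /andP[-> /=].
exact: sub_all.
Qed.

Lemma span_vanish V k a : (r <= k)%N -> span V k a -> a = 0.
Proof.
move=> rk_ [L /allP LP ->]; rewrite big_seq big1 // => cs /LP /andP[/eqP sz _].
suff -> : \prod_(i <- cs.2) x i = 0 by rewrite mulr0.
have := @chow_vanish E M G looplessM buildG GT set0 cs.2.
rewrite !big_set0 mul1r; apply; first by move=> h f _; rewrite inE.
by rewrite sz (leq_trans rk_) // leq_addl.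
Qed.

Definition free_of (i : 'I_n) : pred 'I_n :=
  fun h => ~~ (divF h \subset divF i).

(** This is [chow_vanish] with [S0] reduced to [i], applied to each monomial. *)
Lemma span_ann (i : 'I_n) k a : (r <= rk M (divF i) + k)%N ->
  span (free_of i) k a -> x i * a = 0.
Proof.
move=> rk_ [L /allP LP ->].
rewrite mulr_sumr big_seq big1 // => cs /LP /andP[/eqP sz Vs].
rewrite mulrCA; suff -> : x i * \prod_(j <- cs.2) x j = 0 by rewrite mulr0.
have := @chow_vanish E M G looplessM buildG GT [set i] cs.2.
rewrite !big_set1; apply; last by rewrite sz.
by move=> h f /(allP Vs) hP; rewrite inE => /eqP ->.
Qed.

Lemma span_deg V k a : span V k a -> chow_deg k a.
Proof.
case=> L /allP LP ->.
exists (\sum_(cs <- L) cs.1%:MP * \prod_(i <- cs.2) 'X_i); last first.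
  rewrite -[RHS]/(chow_mor M G _) rmorph_sum; apply: eq_bigr => cs _.
  by rewrite rmorphM (rmorph_prod (chow_mor M G)).
rewrite big_seq rpred_sum // => cs /LP /andP[/eqP <- _].
rewrite mul_mpolyC dhomogZ //.
elim: cs.2 => [|i s IHs] /=; first by rewrite big_nil dhomog1.
by rewrite big_cons -add1n dhomogM // dhomogX /= mdeg1.
Qed.

Lemma chow_comp_zmod k : zmod_morphism (@chow_comp E M G rat k).
Proof.
move=> a b; have piK c : chow_pi M (repr c) = c by exact: reprK.
rewrite -{1}[a]piK -{1}[b]piK -[_ - _]/(chow_mor M G _ - chow_mor M G _).
rewrite -(rmorphB (chow_mor M G)) [LHS]chow_compE raddfB.
exact: (rmorphB (chow_mor M G)).
Qed.
HB.instance Definition _ k := GRing.isZmodMorphism.Build A A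
  (@chow_comp E M G rat k) (chow_comp_zmod k).

Lemma chow_comp_span V j k a : span V k a ->
  chow_comp j a = if j == k then a else 0.
Proof.
move=> /span_deg[p pk ->]; rewrite chow_compE.
case: eqP => [->|/eqP jk]; first by rewrite pihomog_dE.
rewrite eq_sym in jk; rewrite (pihomog_ne0 jk pk).
exact: (rmorph0 (chow_mor M G)).
Qed.

End ChowGrading.

(** * Integration of the Todd factors *)

Lemma factor_expand (R : comNzRingType) (P X W f g : R) c :
  f * g = 1 ->
  P * (X * (W * g) ^+ c) - P = P * g ^+ c * (X * W ^+ c - f ^+ c).
Proof.
move=> fg; have fgc : g ^+ c * f ^+ c = 1 by rewrite -exprMn mulrC fg expr1n.
by rewrite mulrBr -[P * _ * f ^+ c]mulrA fgc exprMn; ring.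
Qed.

Section PushForward.
Variables (E : finType) (M : matroid E) (G : {set {set E}}).
Hypotheses (looplessM : loopless M) (buildG : building_set M G).
Hypothesis GT : [set: E] \in G.
Variable e : E.
Notation n := (ndiv G).
Notation A := (Chow M G rat).
Notation r := (rk M [set: E]).
Notation d := r.-1.
Notation x := (@chow_var E M G).
Notation kappa := (@chow_const E M G).
Notation clA := (@Cl E M G rat).
Notation a := (clA (alpha G e)).
Notation w i := (clA (theta e i)).
Notation y i := (clA (theta e i + xdiv i)).
Notation c i := (rk M (divF i)).
Notation td b := (fsub kappa b toddS).
Notation itd b := (fsub kappa b itoddS).

Lemma rk_gt0 : (0 < r)%N.
Proof. by rewrite -(looplessM e) rk_mono ?subsetT. Qed.

(** Represent alpha by a point outside [divF i]: no set containing it lies in [divF i]. *)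
Lemma span_alpha i : span (free_of i) 1 a.
Proof.
have /subsetPn[b _ bi] : ~~ ([set: E] \subset divF i).
  by rewrite subTset divF_neqT.
rewrite (Cl_alpha M G rat e b) Cl_alphaE; apply: span_sum => j bj.
by apply: span_var; apply: contra bi => /subsetP ->.
Qed.

Lemma theta_E i : w i = a - \sum_(j | divF i \subset divF j) x j.
Proof.
rewrite (raddfB clA) /=; congr (_ - _); rewrite raddf_sum.
by apply: eq_bigr => j _; apply: Cl_xdiv.
Qed.

Lemma span_theta i j : free_of i j -> span (free_of i) 1 (w j).
Proof.
move=> ij; rewrite theta_E; apply: spanD; first exact: span_alpha.
apply: spanN; apply: span_sum => h jh; apply: span_var.
by apply: contra ij; apply: subset_trans.
Qed.

Lemma theta_varE i : y i = w i + x i.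
Proof. by rewrite (raddfD clA) /= Cl_xdiv. Qed.

(** For [j = i], adding [x i] to theta cancels the only variable of its expression not allowed by
    [free_of i]. *)
Lemma span_theta_var i j : (i == j) || free_of i j -> span (free_of i) 1 (y j).
Proof.
case/predU1P=> [<-|ij]; last first.
  rewrite theta_varE; apply: spanD; first exact: span_theta.
  exact: span_var.
rewrite theta_varE theta_E (bigD1 i) //= opprD [- _ - _]addrC.
rewrite -addrA subrK; apply: spanD; first exact: span_alpha.
apply: spanN; apply: span_sum => h /andP[ih hi]; apply: span_var.
apply: contra hi => hi; apply/eqP/divF_inj/eqP.
by rewrite eqEsubset hi.
Qed.

(* The integrals of the multiples of [q] by polynomials in the variables of
   [V] vanish. *)
Definition killed (V : pred 'I_n) (q : A) : Prop :=
  forall l p, span V l p -> chow_comp d (p * q) = 0.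

Lemma killed0 V : killed V 0.
Proof. by move=> l p _; rewrite mulr0 raddf0. Qed.

Lemma killedB V q q' : killed V q -> killed V q' -> killed V (q - q').
Proof.
move=> kq kq' l p Vp.
by rewrite mulrBr chow_comp_zmod (kq l p) // (kq' l p) // subrr.
Qed.

Lemma killedN V q : killed V q -> killed V (- q).
Proof. by move/(killedB (@killed0 V)); rewrite sub0r. Qed.

Lemma killedD V q q' : killed V q -> killed V q' -> killed V (q + q').
Proof. by move=> kq /killedN /(killedB kq); rewrite opprK. Qed.

Lemma killed_sum V (I : Type) (s : seq I) (P : pred I) (F : I -> A) :
  (forall i, P i -> killed V (F i)) -> killed V (\sum_(i <- s | P i) F i).
Proof. by move=> FP; apply: big_ind => //; [exact: killed0 | exact: killedD]. Qed.

Lemma killedM V k b q : span V k b -> killed V q -> killed V (b * q).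
Proof.
by move=> Vb kq l p Vp; rewrite mulrA; apply: kq (spanM Vp Vb).
Qed.

(** If the product has degree [d], its cofactor has degree at least [r - c i] and is annihilated by
    [x i]; otherwise the component of degree [d] is 0. *)
Lemma killed_varX i k : (0 < k < c i)%N -> killed (free_of i) (x i ^+ k).
Proof.
case: k => // k /= kc l p Vp; rewrite exprS.
case: (eqVneq d (l + k.+1)) => [dE|dN].
  rewrite mulrA [p * _]mulrC (span_ann looplessM buildG GT _ Vp) ?mul0r ?raddf0 //.
  rewrite -(prednK rk_gt0) dE -addnS.
  by rewrite [X in (X <= _)%N]addnC leq_add2r.
have sp : span predT (l + k.+1) (p * (x i * x i ^+ k)).
  rewrite -exprS; apply: spanM; first exact: span_sub Vp.
  by have := spanX k.+1 (@span_var _ M _ predT i isT); rewrite mul1n.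
by rewrite (chow_comp_span _ sp) (negPf dN).
Qed.

(** Induction on [j], replacing one factor [w i] by [y i - x i]; multiplication by [y i] preserves
    [killed]. *)
Lemma killed_var_theta i k j : (0 < k)%N -> (k + j < c i)%N ->
  killed (free_of i) (x i ^+ k * w i ^+ j).
Proof.
elim: j k => [|j IHj] k k0 kj.
  by rewrite mulr1; apply: killed_varX; rewrite k0 -(addn0 k).
have -> : x i ^+ k * w i ^+ j.+1 =
    y i * (x i ^+ k * w i ^+ j) - x i ^+ k.+1 * w i ^+ j.
  by rewrite theta_varE !exprS; move: (w i) (x i) => u v; ring.
apply: killedB; last by apply: IHj; rewrite // addSnnS.
apply: killedM; first by apply: (@span_theta_var i i); rewrite eqxx.
by apply: IHj => //; apply: leq_trans kj; rewrite addnS.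
Qed.

(** The difference of powers is divisible by [x i], and each term of the quotient falls under
    [killed_var_theta]. *)
Lemma killed_thetaX i k : (k < c i)%N -> killed (free_of i) (w i ^+ k - y i ^+ k).
Proof.
move=> kc; rewrite subrXX mulr_sumr; apply: killed_sum => j _.
have -> : w i - y i = - x i by rewrite theta_varE opprD addrA subrr sub0r.
rewrite mulNr; apply: killedN; rewrite mulrA [_ * y i ^+ _]mulrC.
apply: (@killedM _ (1 * j)); first by apply/spanX/span_theta_var; rewrite eqxx.
rewrite -[x i]expr1; apply: killed_var_theta => //.
apply: leq_trans kc; rewrite add1n ltnS.
by case: k j => [[]//|k j]; rewrite ltnS leq_subr.
Qed.

(** Evaluate the universal identity at [y i] and [w i]. Powers of [w i] from [c i] on vanish by
    [theta_nilp], and the lower ones can be replaced by powers of [y i] by [killed_thetaX]; this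
    gives the value of [at_diag], known from [at_diag_blowup]. *)
Lemma killed_blowup i m :
  killed (free_of i) ((td (x i) * td (w i) ^+ c i) m - (td (y i) ^+ c i) m).
Proof.
pose eps0 : {rmorphism {poly rat} -> A} :=
  horner_morph (fun b : rat => mulrC (y i) (kappa b)).
pose eps : {rmorphism {poly {poly rat}} -> A} :=
  horner_morph (fun b : {poly rat} => mulrC (w i) (eps0 b)).
have eps0X : eps0 'X = y i by exact: horner_morphX.
have eps0C b : eps0 b%:P = kappa b by exact: horner_morphC.
have epsX : eps 'X = w i by exact: horner_morphX.
have epsC b : eps b%:P = eps0 b by exact: horner_morphC.
have c0 : (0 < c i)%N by apply: building_rk_gt0 looplessM buildG _ (divF_mem i).
have eps0E p : eps0 p = \sum_(j < size p) kappa p`_j * y i ^+ j.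
  rewrite -{1}(coefK p) poly_def rmorph_sum; apply: eq_bigr => j _.
  by rewrite -mul_polyC rmorphM rmorphXn /= eps0C eps0X.
(* Padding the size by [c i] allows the sum to be split at [c i] whatever the degree of [q]. *)
have epsE q : eps q = \sum_(k < c i) eps0 q`_k * w i ^+ k.
  transitivity (eps (\poly_(k < c i + size q) q`_k)).
    congr (eps _); apply/polyP => k; rewrite coef_poly; case: ltnP => // ck.
    by rewrite nth_default // (leq_trans _ ck) // leq_addl.
  rewrite poly_def rmorph_sum big_split_ord /= [X in _ + X]big1 ?addr0.
    by apply: eq_bigr => k _; rewrite -mul_polyC rmorphM rmorphXn /= epsC epsX.
  move=> k _; rewrite -mul_polyC rmorphM rmorphXn /= epsX exprD.
  by rewrite theta_nilp // mul0r mulr0.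
have -> : td (x i) * td (w i) ^+ c i = fsub eps 1 (blowup_todd (c i)).
  rewrite rmorphM rmorphXn /=.
  rewrite !(@fsub_comp _ _ _ _ _ kappa); try by move=> b; rewrite /= epsC eps0C.
  rewrite rmorphB /= epsX epsC eps0X !mulr1; congr (td _ * _).
  by rewrite theta_varE addrC addKr.
have -> : td (y i) ^+ c i = fsub eps0 1 (fsub polyC 'X toddS ^+ c i).
  rewrite rmorphXn /= (@fsub_comp _ _ _ _ _ kappa) ?eps0X ?mulr1 //.
  by move=> b; rewrite eps0C.
rewrite !fcoef_fsub !expr1n !mulr1 -(prednK c0) -at_diag_blowup (prednK c0).
move: (fcoef _ m) => q; rewrite epsE /at_diag rmorph_sum -sumrB.
apply: killed_sum => k _; rewrite rmorphM rmorphXn /= eps0X -mulrBr eps0E.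
rewrite mulr_suml; apply: killed_sum => j _.
apply: (@killedM _ (1 * j)); first by apply/spanZ/spanX/span_theta_var; rewrite eqxx.
exact: killed_thetaX.
Qed.

(** The Todd class of the summand of the tangent class indexed by [i], as a series. *)
Definition todd_factor i : fps A := td (x i) * (td (w i) * itd (y i)) ^+ c i.

Lemma td_itd b : td b * itd b = 1.
Proof. by rewrite -rmorphM todd_itodd rmorph1. Qed.

Lemma killed_factor i (P : fps A) m : graded (free_of i) P ->
  killed (free_of i) ((P * todd_factor i) m - P m).
Proof.
move=> gP; rewrite -fcoefB.
have -> : P * todd_factor i - P = P * itd (y i) ^+ c i
    * (td (x i) * td (w i) ^+ c i - td (y i) ^+ c i).
  exact: factor_expand (td_itd (y i)).
rewrite fcoefM; apply: killed_sum => j _; apply: (@killedM _ j).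
  apply: gradedM => //; apply: gradedX; apply: graded_fsub.
  by apply: span_theta_var; rewrite eqxx.
by rewrite fcoefB; apply: killed_blowup.
Qed.

(** The factors after [i] only involve variables allowed by [free_of i], so [killed_factor] removes
    the factor of [i] first. *)
Lemma push_forward_seq (s : seq 'I_n) l k :
  pairwise (fun i j => free_of i j) s ->
  chow_comp d (a ^+ l * (td a ^+ r * \prod_(i <- s) todd_factor i) k)
  = chow_comp d (a ^+ l * (td a ^+ r) k).
Proof.
elim: s => [|i s IHs]; first by rewrite big_nil mulr1.
case/andP=> /allP is_ /IHs <-; rewrite big_cons.
set P := td a ^+ r * \prod_(i <- s) todd_factor i.
have gP : graded (free_of i) P.
  rewrite /P big_seq; apply: gradedM.
    by apply/gradedX/graded_fsub/span_alpha.
  apply: graded_prod => j /is_ ij; rewrite /todd_factor.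
  apply: gradedM; first by apply/graded_fsub/span_var.
  apply/gradedX/gradedM; apply: graded_fsub; first exact: span_theta.
  by apply: span_theta_var; rewrite ij orbT.
have al : span (free_of i) (1 * l) (a ^+ l) by apply/spanX/span_alpha.
have := @killed_factor i P k gP _ _ al.
rewrite mulrBr chow_comp_zmod => /eqP; rewrite subr_eq0 => /eqP <-.
by rewrite [todd_factor i * _]mulrC mulrA.
Qed.

Lemma push_forward l k :
  chow_comp d (a ^+ l * (td a ^+ r * \prod_i todd_factor i) k)
  = chow_comp d (a ^+ l * (td a ^+ r) k).
Proof.
(* After sorting by cardinality, a later flat is at least as large and distinct, hence not contained
   in an earlier one. *)
pose s := sort (relpre (fun i : 'I_n => #|divF i|) leq) (enum 'I_n).
rewrite -(@push_forward_seq s).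
  by rewrite -[in LHS]big_enum (perm_big s) // perm_sym perm_sort.
have us : uniq s by rewrite sort_uniq enum_uniq.
have ps : pairwise (relpre (fun i : 'I_n => #|divF i|) leq) s.
  rewrite -sorted_pairwise; last by move=> i j h; apply: leq_trans.
  by apply: sort_sorted => i j; apply: leq_total.
have := us; rewrite uniq_pairwise => us'.
have : pairwise
    [rel i j | (relpre (fun i : 'I_n => #|divF i|) leq i j) && (i != j)] s.
  by rewrite pairwise_relI ps us'.
apply: sub_pairwise => i j /= /andP[ij]; apply: contra => ji.
by rewrite -(inj_eq (@divF_inj E G)) eq_sym eqEcard ji.
Qed.

End PushForward.

(** * The Todd class of the tangent class *)

Section ToddTangent.
Variables (E : finType) (M : matroid E) (G : {set {set E}}).
Hypotheses (looplessM : loopless M) (buildG : building_set M G).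
Hypothesis GT : [set: E] \in G.
Variable e : E.
Notation n := (ndiv G).
Notation A := (Chow M G rat).
Notation r := (rk M [set: E]).
Notation d := r.-1.
Notation kappa := (@chow_const E M G).
Notation clA := (@Cl E M G rat).
Notation O := (@line_bundle E M G).

(* The value at [T = 1], for series which are polynomials of degree at most
   [d]. *)
Definition total (u : fps A) : A := \sum_(k < d.+1) u k.

Lemma totalE u : total u = (fps_trunc d.+1 u).[1].
Proof. by rewrite horner_poly; apply: eq_bigr => k _; rewrite expr1n mulr1. Qed.

Lemma total1 : total 1 = 1.
Proof. by rewrite /total big_ord_recl big1 ?addr0. Qed.

(** The terms of the product lost by truncation have degree at least [r], where the Chow ring
    vanishes. *)
Lemma totalM u v : graded predT u -> graded predT v ->
  total (u * v) = total u * total v.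
Proof.
move=> gu gv; rewrite !totalE -hornerM; congr (_.[_]); apply/polyP => k.
rewrite coef_poly; case: ltnP => kN; first exact: fps_mul_trunc.
rewrite coefM big1 // => i _; rewrite !coef_poly.
case: ifP => _; last by rewrite mul0r.
case: ifP => _; last by rewrite mulr0.
apply: (span_vanish looplessM buildG GT (V := predT) (k := k)).
  by apply: leq_trans kN; rewrite leqSpred.
by have := spanM (gu i) (gv (k - i)%N); rewrite subnKC // -ltnS.
Qed.

Lemma totalX u m : graded predT u -> total (u ^+ m) = total u ^+ m.
Proof.
move=> gu; elim: m => [|m IHm]; first exact: total1.
by rewrite !exprS totalM ?IHm //; apply: gradedX.
Qed.

Lemma total_prod (I : Type) (s : seq I) (F : I -> fps A) :
  (forall i, graded predT (F i)) ->
  total (\prod_(i <- s) F i) = \prod_(i <- s) total (F i).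
Proof.
move=> gF; elim: s => [|i s IHs]; first by rewrite !big_nil total1.
by rewrite !big_cons totalM ?IHs //; apply: graded_prod.
Qed.

Lemma span_Cl (D : Div G) : span predT 1 (clA D).
Proof.
by rewrite ClE; apply: span_sum => i _; apply/spanZ/span_var.
Qed.

Lemma graded_Cl (D : Div G) u : graded predT (fsub kappa (clA D) u).
Proof. exact/graded_fsub/span_Cl. Qed.

Lemma graded_factor (i : 'I_n) : graded predT (todd_factor M e i).
Proof.
rewrite /todd_factor -Cl_xdiv; apply: gradedM; first exact: graded_Cl.
by apply/gradedX/gradedM; apply: graded_Cl.
Qed.

Variable td : Kring M G -> A.
Hypothesis todd_td : is_todd td.

Lemma todd_lineE (D : Div G) : td (O D) = total (fsub kappa (clA D) toddS).
Proof. by rewrite todd_td.2. Qed.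

Lemma todd1 : td 1 = 1.
Proof.
rewrite -(O0 M G) todd_lineE (raddf0 clA) /total big_ord_recl big1.
  by rewrite addr0 fcoef_fsub mulr1 /= todd_coef0 rmorph1.
by move=> k _; rewrite fcoef_fsub expr0n mulr0.
Qed.

Lemma todd0 : td 0 = 1.
Proof. by have := todd_td.1 1 0; rewrite addr0 todd1 mul1r. Qed.

Lemma toddMn z m : td (z *+ m) = td z ^+ m.
Proof.
elim: m => [|m IHm]; first by rewrite todd0.
by rewrite mulrS todd_td.1 IHm exprS.
Qed.

Lemma toddN z b : td z * b = 1 -> td (- z) = b.
Proof.
move=> zb; have := todd_td.1 z (- z); rewrite subrr todd0 => zz.
by rewrite -[LHS]mul1r -zb mulrAC -zz mul1r.
Qed.

Lemma todd_lineN (D : Div G) : td (- O D) = total (fsub kappa (clA D) itoddS).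
Proof.
apply: toddN; rewrite todd_lineE -totalM; try exact: graded_Cl.
by rewrite td_itd total1.
Qed.

(** Todd classes turn sums into products: trivial bundles contribute 1, and the negative line
    bundles contribute [itoddS]. *)
Lemma todd_tangent : td (tangent M G e) =
  total (fsub kappa (clA (alpha G e)) toddS ^+ r * \prod_i todd_factor M e i).
Proof.
have td1N : td (- 1) = 1 by apply: toddN; rewrite todd1 mulr1.
rewrite totalM; first last.
- by apply: graded_prod => i _; apply: graded_factor.
- by apply: gradedX; apply: graded_Cl.
rewrite totalX; last exact: graded_Cl.
rewrite total_prod; last exact: graded_factor.
rewrite /tangent !todd_td.1 toddMn todd_lineE td1N mulr1; congr (_ * _).
rewrite (big_morph td todd_td.1 todd0); apply: eq_bigr => i _.
rewrite !todd_td.1 toddMn todd_td.1 td1N mulr1 !todd_lineE todd_lineN Cl_xdiv.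
have gx : graded predT (fsub kappa (chow_var M i) toddS).
  by rewrite -Cl_xdiv; apply: graded_Cl.
have gw := graded_Cl (theta e i) toddS.
have gy := graded_Cl (theta e i + xdiv i) itoddS.
rewrite /todd_factor totalM //; last by apply/gradedX/gradedM.
by rewrite totalX ?totalM //; apply: gradedM.
Qed.

Lemma chow_comp_total (u : fps A) k : (k <= d)%N -> graded predT u ->
  chow_comp k (total u) = u k.
Proof.
move=> kd gu; rewrite /total raddf_sum (bigD1 (Ordinal (kd : (k < d.+1)%N))) //=.
rewrite (chow_comp_span _ (gu k)) eqxx big1 ?addr0 // => j.
rewrite (chow_comp_span _ (gu j)) -val_eqE /= eq_sym.
by case: eqP.
Qed.

(** By [push_forward] only the Todd series of alpha to the power [r] remains; its part of degree [k]
    is a rational multiple of the power [k] of alpha, and alpha to the power [d] has degree 1. *)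
Lemma degree_todd (deg : A -> rat) k : is_degree deg -> (k <= d)%N ->
  deg (clA (alpha G e) ^+ (d - k) * chow_comp k (td (tangent M G e)))
  = (toddS ^+ d.+1) k.
Proof.
case=> deg_lin _ _ deg1 kd; set a := clA (alpha G e).
have ga := graded_Cl (alpha G e) toddS.
have gZ : graded predT (fsub kappa a toddS ^+ r * \prod_i todd_factor M e i).
  apply: gradedM; first exact: gradedX.
  by apply: graded_prod => i _; apply: graded_factor.
have sa m : span predT m (a ^+ m).
  by have := spanX m (span_Cl (alpha G e)); rewrite mul1n.
rewrite todd_tangent chow_comp_total //.
(* [push_forward] concerns components of degree [d], so these are inserted and removed around it. *)
have compd b :
    span predT k b -> chow_comp d (a ^+ (d - k) * b) = a ^+ (d - k) * b.
  move=> bk; have := spanM (sa (d - k)%N) bk.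
  by rewrite subnK // => /chow_comp_span->; rewrite eqxx.
rewrite -(compd _ (gZ k)) push_forward // compd; last exact: gradedX.
have -> : (fsub kappa a toddS ^+ r) k = kappa ((toddS ^+ r) k) * a ^+ k.
  by rewrite -rmorphXn.
rewrite mulrCA -exprD subnK //.
(* The map [deg] is not a bundled morphism, so its value at 0 comes from linearity in degree [d]. *)
have deg0 : deg 0 = 0.
  have z0 : chow_deg d (0 : A) by apply: span_deg (@span0 _ _ _ predT d).
  have := deg_lin 1 0 0 z0 z0; rewrite chow_scalE mulr0 addr0 mul1r => /eqP.
  by rewrite -{1}[deg 0]addr0 eq_sym (inj_eq (addrI _)) => /eqP.
have /deg_lin lin : chow_deg d (a ^+ d) by apply: span_deg (sa d).
rewrite -chow_scalE -[scal _ _]addr0 lin; last first.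
  exact: span_deg (@span0 _ _ _ predT d).
by rewrite deg1 deg0 addr0 mulr1 (prednK (rk_gt0 looplessM e)).
Qed.

End ToddTangent.

(** * Comparison with the binomial polynomial *)

(** Take [z = 'X] in [expS_td_coef] and expand the product with the exponential series. *)
Lemma binom_poly d :
  (d`!%:R)^-1 *: \prod_(1 <= j < d.+1) ('X + j%:R%:P)
  = \poly_(i < d.+1) ((toddS ^+ d.+1) (d - i)%N / i`!%:R) :> {poly rat}.
Proof.
have := expS_td_coef polyC d 'X; rewrite mul_polyC.
have -> : \prod_(1 <= j < d.+1) ('X + j%:R) =
    \prod_(1 <= j < d.+1) ('X + j%:R%:P) :> {poly rat}.
  by apply: eq_bigr => j _; rewrite polyC_natr.
move=> <-; rewrite fcoefM poly_def; apply: eq_bigr => i _.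
rewrite -rmorphXn /= expr1n mulr1 mulrAC -rmorphM mul_polyC; congr (_ *: _).
by rewrite mulrC.
Qed.

Theorem corollary4p15 (E : finType) (e : E) (M : matroid E)
    (G : {set {set E}}) (td : Kring M G -> Chow M G rat)
    (deg : Chow M G rat -> rat) :
  loopless M -> building_set M G -> [set: E] \in G ->
  is_todd td -> is_degree deg ->
  let d := (rk M [set: E]).-1 in
  let a := Cl M rat (alpha G e) in
  let td_ k := chow_comp k (td (tangent M G e)) in
  let binom : {poly rat} :=
    (d`!%:R)^-1 *: \prod_(1 <= j < d.+1) ('X + j%:R%:P) in
  \sum_(k < d.+1)
     (deg (a ^+ (d - k) * td_ k) / (d - k)`!%:R) *: 'X^(d - k) = binom
  /\
  forall k : nat, (k <= d)%N ->
    deg (a ^+ (d - k) * td_ k) = (d - k)`!%:R * binom`_(d - k).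
Proof.
move=> loopM buildG GT tdP degP d a td_ binom.
have degE k : (k <= d)%N -> deg (a ^+ (d - k) * td_ k) = (toddS ^+ d.+1) k.
  exact: degree_todd loopM buildG GT e td tdP deg k degP.
have binomE : binom = \poly_(i < d.+1) ((toddS ^+ d.+1) (d - i)%N / i`!%:R).
  exact: binom_poly.
split=> [|k kd]; last first.
  rewrite degE // binomE coef_poly ltnS leq_subr subKn // mulrC divfK //.
  by rewrite Num.Theory.pnatr_eq0 -lt0n fact_gt0.
(* Reversal exchanges the index [k] of the Todd class with the exponent [d - k] of the variable. *)
rewrite binomE poly_def (reindex_inj rev_ord_inj); apply: eq_bigr => k _ /=.
by rewrite subSS degE ?leq_subr // subKn // -ltnS.
Qed.
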